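(* Let $f$ be a computable function of two arguments and let $\Pi=(\mathcal R,t)$ be a nondeterministic protocol on domain $D=\{0,1\}^{n_1}\times\{0,1\}^{n_2}$ that computes $f$. Then for every $(x,y)\in D$, writing $f_{x,y}=f(x,y)$ and $t_{x,y}=t(x,y)$, $$C(t_{x,y}\mid\Pi)\ \ge\ C(f_{x,y}\mid x,\Pi)+C(f_{x,y}\mid y,\Pi)+C(t_{x,y}\mid x,f_{x,y},\Pi)+C(t_{x,y}\mid y,f_{x,y},\Pi)-\log\rho(t_{x,y}) - O(\log n),$$ where $n$ is the maximum length of the strings involved.
   Context: Fix a universal Turing machine $U$. $C(x\mid u)$ is the length of a shortest $p$ with $U(p,u)=x$; tuples and finite objects are encoded as strings by fixed computable encodings. A rectangle in $D$ is a set of the form $S\times T$. A (nondeterministic) protocol $\Pi=(\mathcal R,t)$ consists of a finite set $\mathcal R$ of rectangles whose union contains $D$, and a function $t$ assigning to each $(x,y)\in D$ a rectangle $t(x,y)\in\mathcal R$ containing $(x,y)$. $\Pi$ is regarded as a finite object (listing $\mathcal R$ and the table of $t$), and the rectangle $t(x,y)$ is identified with a string encoding its index in $\mathcal R$. $\Pi$ computes $f$ if every rectangle of $\mathcal R$ is $f$-monochromatic ($f$ is constant on it). The thickness $\rho_{x,y}$ of a cell is the number of rectangles of $\mathcal R$ containing it; the thickness of a rectangle $R$ is $\rho(R)=\max_{(x,y)\in R}\rho_{x,y}$. *)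

(* Defs.v *)
From HB Require Import structures.
From Stdlib Require Import BinPos.
From mathcomp Require Import all_boot all_order all_algebra.
From mathcomp Require Import boolp reals exp.

Set Implicit Arguments.
Unset Strict Implicit.
Unset Printing Implicit Defensive.

Import Order.TTheory GRing.Theory Num.Theory.

Definition string := seq bool.

(** * Turing machines *)

(* Deterministic multi-tape machines over the alphabet {0, 1, blank};
   [None] is the blank. *)
Definition symbol := option bool.

Variant head_move := MoveLeft | MoveRight | Stay.

(* A two-way infinite tape: [t.1] lists the cells left of the head, nearest
   first, and [t.2] the cells from the head rightwards. Cells beyond the two
   lists are blank. *)
Definition tape : Type := seq symbol * seq symbol.

Definition tape_read (t : tape) : symbol := head None t.2.

Definition tape_write (a : symbol) (t : tape) : tape := (t.1, a :: behead t.2).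

Definition tape_move (m : head_move) (t : tape) : tape :=
  match m with
  | MoveLeft => (behead t.1, head None t.1 :: t.2)
  | MoveRight => (tape_read t :: t.1, behead t.2)
  | Stay => t
  end.

(* Tapes 0 and 1 hold the two arguments, tape 2 the result; there are
   [tm_work] further work tapes. *)
Record turing_machine := TuringMachine {
  tm_work : nat;
  tm_state : finType;
  tm_start : tm_state;
  tm_halt : pred tm_state;
  tm_delta : tm_state -> tm_work.+3.-tuple symbol ->
             tm_state * tm_work.+3.-tuple (symbol * head_move) }.

Definition tm_config (M : turing_machine) : Type :=
  tm_state M * (tm_work M).+3.-tuple tape.

Definition tm_step (M : turing_machine) (c : tm_config M) : tm_config M :=
  if tm_halt c.1 then c else
  let d := tm_delta c.1 [tuple of map tape_read c.2] in
  (d.1, [tuple tape_move (tnth d.2 i).2 (tape_write (tnth d.2 i).1 (tnth c.2 i))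
        | i < (tm_work M).+3]).

Definition tape_of_string (s : string) : tape := ([::], map Some s).

Definition tm_init (M : turing_machine) (p u : string) : tm_config M :=
  (tm_start M,
   [tuple tape_of_string (nth [::] [:: p; u] i) | i < (tm_work M).+3]).

(* The result is read from the head of tape 2 up to the first blank. *)
Definition tm_output (M : turing_machine) (c : tm_config M) : string :=
  let r := (nth ([::], [::]) c.2 2).2 in
  pmap id (take (index None r) r).

(* [M(p, u) = x]: M halts on (p, u) with output x. *)
Definition tm_computes (M : turing_machine) (p u x : string) : Prop :=
  exists m : nat, let c := iter m (@tm_step M) (tm_init M p u) in
    tm_halt c.1 /\ tm_output c = x.

Definition computable (f : string -> string -> string) : Prop :=
  exists M : turing_machine, forall x y : string, tm_computes M x y (f x y).

(* U simulates every machine V at the price of O(1) extra program bits. This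
   holds in particular if [V(p, u) = U(w_V ++ p, u)] for some prefix [w_V]. *)
Definition universal (U : turing_machine) : Prop :=
  forall V : turing_machine, exists c : nat,
  forall p u x : string, tm_computes V p u x ->
  exists2 q : string, (size q <= size p + c)%N & tm_computes U q u x.

(** * Conditional Kolmogorov complexity *)

Definition has_program (U : turing_machine) (x u : string) : pred nat :=
  fun k => `[< exists2 p : string, size p = k & tm_computes U p u x >].

(* The default value 0 is never used when U is universal. *)
Definition KC (U : turing_machine) (x u : string) : nat :=
  match pselect (exists k, has_program U x u k) with
  | left ex => ex_minn ex
  | right _ => 0%N
  end.

(** * Encodings *)

(* Self-delimiting: each entry has its bits doubled and is closed by 01. *)
Definition enc_seq (l : seq string) : string :=
  flatten [seq flatten [seq [:: b; b] | b <- s] ++ [:: false; true] | s <- l].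

Fixpoint pos_string (p : positive) : string :=
  match p with
  | xH => [::]
  | xO q => false :: pos_string q
  | xI q => true :: pos_string q
  end.

(* The bijection from nat to strings that sends i to the binary expansion of
   i + 1, least significant bit first and without its leading 1. *)
Definition nat_string (i : nat) : string := pos_string (Pos.of_succ_nat i).

(** * Nondeterministic protocols *)

Section Protocol.
Variables n1 n2 : nat.

Definition cell : Type := (n1.-tuple bool * n2.-tuple bool)%type.

Definition is_rectangle (R : {set cell}) : Prop :=
  exists (S : {set n1.-tuple bool}) (T : {set n2.-tuple bool}), R = setX S T.

(* The finite set of rectangles is given by a duplicate-free list, which fixes
   the index of each rectangle. *)
Record protocol := Protocol {
  rects : seq {set cell};
  rects_uniq : uniq rects;
  rects_rectangle : forall R, R \in rects -> is_rectangle R;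
  rects_cover : forall c : cell, exists2 R, R \in rects & c \in R;
  rect_at : cell -> {set cell};
  rect_at_rects : forall c, rect_at c \in rects;
  mem_rect_at : forall c, c \in rect_at c }.

Definition protocol_computes (P : protocol) (f : string -> string -> string) :
    Prop :=
  forall R, R \in rects P ->
  forall c c' : cell, c \in R -> c' \in R -> f c.1 c.2 = f c'.1 c'.2.

Definition rect_string (P : protocol) (R : {set cell}) : string :=
  nat_string (index R (rects P)).

Definition cell_thickness (P : protocol) (c : cell) : nat :=
  count (fun R : {set cell} => c \in R) (rects P).

Definition thickness (P : protocol) (R : {set cell}) : nat :=
  \max_(c in R) cell_thickness P c.

Definition enc_rect (R : {set cell}) : string :=
  enc_seq [seq enc_seq [:: tval c.1; tval c.2] | c <- enum R].

Definition enc_table (P : protocol) : string :=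
  enc_seq [seq enc_seq [:: tval c.1; tval c.2; rect_string P (rect_at P c)]
          | c <- enum {: cell}].

Definition enc_protocol (P : protocol) : string :=
  enc_seq [:: enc_seq [seq enc_rect R | R <- rects P]; enc_table P].

End Protocol.

Definition log2 (R : realType) (x : R) : R := (ln x / ln 2)%R.

(* Main.v *)
Require Import Defs.
From Stdlib Require Import BinPos.
From mathcomp Require Import all_boot all_order all_algebra.
From mathcomp Require Import boolp reals exp.
From mathcomp Require Import zify lra.

Set Implicit Arguments.
Unset Strict Implicit.
Unset Printing Implicit Defensive.

(* Put [m = C(t|Pi)], [a = C(x|Pi)], [b = C(y|Pi)], and let [V], [W] be the sets
   of rows of complexity at most [a] and of columns of complexity at most [b]
   of the rectangle [t]. The rectangles of complexity at most [m] and thickness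
   at most [rho] whose sets [V], [W] are at least as large as those of [t] can
   be enumerated, so there are about [2^m] of them. Each cell lies in at most
   [rho] of them, and counting triples (rectangle, row, column) gives
   [m + log|V| + log|W| <= a + b + log rho], up to [O(log n)].

   Let [k] be the logarithm of the number of rectangles of complexity at most
   [m] that have [x] among the first [2|V|] enumerated elements of their [V].
   At most [2^m |V| / 2^k] rows have so many rectangles, whence
   [a + k <= m + log|V|]. Given [x], grouping these rectangles by their
   value of [f] yields [C(f|x,Pi) + C(t|x,f,Pi) <= k]. The same holds for [y],
   and adding up proves the theorem.

   All enumerations proceed by stages: at stage [s] every machine involved is
   run for [s] steps. That they are performed by Turing machines is shown by
   compiling programs on unary counters, with Cantor pairing to code data. *)

(** * Flowcharts and Turing machines *)

(** One principle, [description], turns counting into complexity: a member of a set that is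
    enumerable from the condition and has at most 2^k elements has complexity at most about k. A
    bound on the number of rich rectangles thus bounds m, and a bound on the number of rows with
    many rectangles bounds a. The quantities a, b, log|V|, log|W| and both values of k cancel in the
    final sum, so they may stay unknown as long as a program can be told them: each is an integer of
    size O(n) and costs O(log n) bits. The size of V is only approached from below by an enumeration
    and never known to be final; therefore powers of two stand in for it, and cutting each V off at
    2|V| elements keeps rectangles with a larger V than that of t from spoiling the count. The
    logarithm of rho is a parameter as well; when it exceeds 4n + O(1), the inequality is trivial.
    Since universality speaks of machines only, every enumeration needs an actual Turing machine,
    and much of the proof is a small theory of computability built for this purpose. *)

Definition upd (T : Type) (s : nat -> T) (i : nat) (v : T) : nat -> T :=
  fun j => if j == i then v else s j.

Lemma upd_same T (s : nat -> T) i v : upd s i v i = v.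
Proof. by rewrite /upd eqxx. Qed.

Lemma upd_neq T (s : nat -> T) i j v : j != i -> upd s i v j = s j.
Proof. by rewrite /upd => /negbTE->. Qed.

Lemma upd_id T (s : nat -> T) i : upd s i (s i) = s.
Proof. by apply: funext => j; rewrite /upd; case: eqP => [->|]. Qed.

Lemma upd_upd T (s : nat -> T) i v w : upd (upd s i v) i w = upd s i w.
Proof. by apply: funext => j; rewrite /upd; case: eqP. Qed.

(* Tapes up to trailing blanks: the machine writes on every tape at every
   step, which turns an empty list of cells into an explicit blank. *)
Definition atape : Type := ((nat -> symbol) * (nat -> symbol))%type.

Definition aread (t : atape) : symbol := t.2 0.

Definition awrite (a : symbol) (t : atape) : atape :=
  (t.1, fun j => if j is j'.+1 then t.2 j else a).

Definition amove (m : head_move) (t : atape) : atape :=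
  match m with
  | MoveLeft => (fun j => t.1 j.+1, fun j => if j is j'.+1 then t.2 j' else t.1 0)
  | MoveRight => (fun j => if j is j'.+1 then t.1 j' else t.2 0, fun j => t.2 j.+1)
  | Stay => t
  end.

Definition abs (t : tape) : atape := (nth None t.1, nth None t.2).

Lemma abs_read t : aread (abs t) = tape_read t.
Proof. by rewrite /aread /tape_read /= nth0. Qed.

Lemma abs_write a t : abs (tape_write a t) = awrite a (abs t).
Proof.
rewrite /abs /awrite /=; congr pair; apply: funext => -[|j] //=.
by rewrite nth_behead.
Qed.

Lemma abs_move m t : abs (tape_move m t) = amove m (abs t).
Proof.
case: m => //; rewrite /abs /amove /tape_move /tape_read /=;
  congr pair; apply: funext => j; rewrite ?nth_behead //;
  by case: j => //=; rewrite nth0.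
Qed.

Lemma awrite_read t : awrite (aread t) t = t.
Proof. by case: t => l r; congr pair; apply: funext => -[]. Qed.

Definition store := nat -> atape.

(* A flowchart with one entry and one exit ([None]); the state [q] reads,
   writes and moves on the single tape [ftape q]. *)
Record frag := Frag {
  fstate : finType;
  fstart : fstate;
  ftape : fstate -> nat;
  fdelta : fstate -> symbol -> option fstate * (symbol * head_move) }.

Definition fstep (F : frag) (c : option (fstate F) * store) :=
  if c.1 is Some q then
    let i := ftape q in let d := fdelta q (aread (c.2 i)) in
    (d.1, upd c.2 i (amove d.2.2 (awrite d.2.1 (c.2 i))))
  else c.

Definition exec (F : frag) (s s' : store) : Prop :=
  exists n, iter n (@fstep F) (Some (fstart F), s) = (None, s').

Section Compile.
Variable F : frag.

Definition fwork : nat := \max_(q : fstate F) ftape q.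

Definition compile : turing_machine :=
  @TuringMachine fwork (option (fstate F) : finType) (Some (fstart F))
    (fun q => q == None)
    (fun q r =>
       if q is Some q0 then
         let d := fdelta q0 (nth None r (ftape q0)) in
         (d.1, [tuple if (i : nat) == ftape q0 then d.2 else (tnth r i, Stay)
               | i < fwork.+3])
       else (None, [tuple (tnth r i, Stay) | i < fwork.+3])).

Definition sim (c : tm_config compile) (d : option (fstate F) * store) : Prop :=
  c.1 = d.1 /\ forall i : 'I_fwork.+3, abs (tnth c.2 i) = d.2 i.

Lemma ftape_lt (q : fstate F) : ftape q < fwork.+3.
Proof. by rewrite ltnS; apply: leq_trans (leq_bigmax q) _; rewrite ltnW. Qed.

Lemma sim_step c d : sim c d -> sim (tm_step c) (fstep d).
Proof.
case: c d => [q ts] [q' s] [/= <- simts]; rewrite /tm_step /fstep /=.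
case: q => [q|] //=.
have Eq : nth None [tuple of map tape_read ts] (ftape q) = aread (s (ftape q)).
  pose i := Ordinal (ftape_lt q).
  rewrite -[ftape q]/(val i) -tnth_nth tnth_map.
  by rewrite -simts abs_read.
split=> /=; first by rewrite Eq.
move=> i; rewrite !tnth_mktuple Eq /upd; case: eqP => [Ei|_].
  by rewrite abs_move abs_write simts Ei.
by rewrite /= tnth_map abs_write -abs_read awrite_read simts.
Qed.

Lemma sim_iter n c d : sim c d ->
  sim (iter n (@tm_step compile) c) (iter n (@fstep F) d).
Proof. by move=> cd; elim: n => //= n IH; apply: sim_step. Qed.

(** [tm_output] stops at the first blank, so it cannot tell apart tapes that agree up to trailing
    blanks. *)
Lemma output_abs r (z : string) : nth None r =1 nth None (map Some z) ->
  pmap id (take (index None r) r) = z.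
Proof.
elim: z r => [|b z IH] r; first by case: r => // -[a|] r // /(_ 0).
case: r => [/(_ 0)//|[a|] r E]; last by have /= := E 0.
have /= [->] := E 0; rewrite IH // => j; exact: E j.+1.
Qed.

Definition init_store (p u : string) : store :=
  fun i => abs (tape_of_string (nth [::] [:: p; u] i)).

Lemma exec_computes p u z s : exec F (init_store p u) s ->
  (s 2).2 = nth None (map Some z) -> tm_computes compile p u z.
Proof.
case=> n En Es; exists n; set c := iter _ _ _.
have simc : sim c (None, s).
  by rewrite -En; apply: sim_iter; split=> //= i; rewrite tnth_mktuple.
case: simc => /= Ec1 Ec2; split; first by rewrite Ec1.
rewrite /tm_output; apply: output_abs => j.
by rewrite -Es -(Ec2 (@Ordinal fwork.+3 2 isT)) /= (tnth_nth ([::], [::])).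
Qed.

End Compile.

(** * Composition of flowcharts *)

Definition act (i : nat) (g : symbol -> symbol * head_move) : frag :=
  @Frag unit tt (fun=> i) (fun _ a => (None, g a)).

Definition seqf (F G : frag) : frag :=
  @Frag (fstate F + fstate G)%type (inl (fstart F))
    (fun q => match q with inl q => ftape q | inr q => ftape q end)
    (fun q a => match q with
     | inl q => let d := fdelta q a in
        (if d.1 is Some q' then Some (inl q') else Some (inr (fstart G)), d.2)
     | inr q => let d := fdelta q a in (omap inr d.1, d.2) end).

(** The exit of the body is identified with the state that tests the condition: when [d.1] is
    [None], [Some d.1] is that state. *)
Definition whilef (i : nat) (b : pred symbol) (F : frag) : frag :=
  @Frag (option (fstate F)) None
    (fun q => if q is Some q then ftape q else i)
    (fun q a => if q is Some q then
        let d := fdelta q a in (Some d.1, d.2)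
      else (if b a then Some (Some (fstart F)) else None, (a, Stay))).

Definition iff (i : nat) (b : pred symbol) (F G : frag) : frag :=
  @Frag (option (fstate F + fstate G)) None
    (fun q => match q with
      Some (inl q) => ftape q | Some (inr q) => ftape q | None => i end)
    (fun q a => match q with
     | Some (inl q) => let d := fdelta q a in (omap (fun q => Some (inl q)) d.1, d.2)
     | Some (inr q) => let d := fdelta q a in (omap (fun q => Some (inr q)) d.1, d.2)
     | None => (Some (if b a then Some (inl (fstart F)) else Some (inr (fstart G))),
                (a, Stay)) end).

Lemma exec_act i g s :
  exec (act i g) s (upd s i (amove (g (aread (s i))).2
                       (awrite (g (aread (s i))).1 (s i)))).
Proof. by exists 1. Qed.

(* A run of [F] is mirrored inside [G] by the embedding [h] of control states,
   where [h None] is the point of [G] reached when [F] exits. *)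
Lemma exec_embed (F G : frag) (h : option (fstate F) -> option (fstate G)) :
  (forall q s, fstep (h (Some q), s) =
     (h (fstep (F := F) (Some q, s)).1, (fstep (F := F) (Some q, s)).2)) ->
  forall n q s s', iter n (@fstep F) (Some q, s) = (None, s') ->
  exists n', iter n' (@fstep G) (h (Some q), s) = (h None, s').
Proof.
move=> hstep; elim=> [//|n IH] q s s'; rewrite iterSr.
case E : (fstep (Some q, s)) => [[q'|] t] /=.
  by move=> /IH[n' En']; exists n'.+1; rewrite iterSr hstep E.
move=> Et; exists 1; rewrite /= hstep E /=; congr pair.
have : iter n (@fstep F) (None, t) = (None, t) by elim: n {IH Et} => //= n ->.
by rewrite Et => -[].
Qed.

Lemma exec_seq F G s1 s2 s3 : exec F s1 s2 -> exec G s2 s3 ->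
  exec (seqf F G) s1 s3.
Proof.
move=> [n En] [m Em].
have [q s|n' En'] := exec_embed (G := seqf F G)
  (h := fun q => Some (if q is Some q then inl q else inr (fstart G))) _ En.
  by rewrite /fstep /=; case: (fdelta _ _).1.
have [q s|m' Em'] := exec_embed (G := seqf F G) (h := omap inr) _ Em.
  by [].
by exists (m' + n'); rewrite iterD En' Em'.
Qed.

Lemma keep_id (s : store) i : upd s i (amove Stay (awrite (aread (s i)) (s i))) = s.
Proof. by rewrite /= awrite_read upd_id. Qed.

Lemma exec_while_stop i (b : pred symbol) F s : ~~ b (aread (s i)) -> exec (whilef i b F) s s.
Proof. by move=> /negbTE nb; exists 1; rewrite /= /fstep /= nb keep_id. Qed.

Lemma exec_while_loop i (b : pred symbol) F s1 s2 s3 : b (aread (s1 i)) -> exec F s1 s2 ->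
  exec (whilef i b F) s2 s3 -> exec (whilef i b F) s1 s3.
Proof.
move=> bs [n En] [m Em].
have [q s|n' En'] := exec_embed (G := whilef i b F) (h := Some) _ En; first by [].
have E1 : fstep (F := whilef i b F) (Some None, s1) = (Some (Some (fstart F)), s1).
  by rewrite /fstep /= bs keep_id.
by exists (m + n'.+1); rewrite iterD iterSr E1 En'.
Qed.

Lemma exec_if i (b : pred symbol) F G s1 s2 :
  exec (if b (aread (s1 i)) then F else G) s1 s2 -> exec (iff i b F G) s1 s2.
Proof.
have E1 : fstep (F := iff i b F G) (Some None, s1) =
    (Some (if b (aread (s1 i)) then Some (inl (fstart F))
           else Some (inr (fstart G))), s1).
  by rewrite /fstep /= keep_id.
case: ifP E1 => bs E1 [n En].
  have [q s|n' En'] := exec_embed (G := iff i b F G)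
    (h := omap (fun q => Some (inl q))) _ En; first by [].
  by exists n'.+1; rewrite iterSr E1 En'.
have [q s|n' En'] := exec_embed (G := iff i b F G)
  (h := omap (fun q => Some (inr q))) _ En; first by [].
by exists n'.+1; rewrite iterSr E1 En'.
Qed.

(** * Counter programs *)

(* The counter value [n] as [n] marks under and right of the head. *)
Definition ctr (n : nat) : atape :=
  (fun=> None, fun j => if j < n then Some true else None).

(* Counters live on the work tapes; [sp] describes the three special tapes. *)
Definition mk (sp : nat -> atape) (r : nat -> nat) : store :=
  fun i => if i < 3 then sp i else ctr (r (i - 3)).

Lemma mk_upd sp r i n : upd (mk sp r) (i + 3) (ctr n) = mk sp (upd r i n).
Proof.
apply: funext => j; rewrite /upd /mk; case: eqP => [->|ji].
  by rewrite ltnNge leq_addl addnK eqxx.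
by case: ltnP => // j3; case: eqP => // E; case: ji; lia.
Qed.

Lemma mk_ctr sp r i : mk sp r (i + 3) = ctr (r i).
Proof. by rewrite /mk ltnNge leq_addl addnK. Qed.

Lemma exec_eq F s t t' : exec F s t -> t = t' -> exec F s t'.
Proof. by move=> ? <-. Qed.

(** Counters grow and shrink at their left end, where the head stands, so neither operation scans
    the tape. *)
Definition inc (i : nat) : frag :=
  seqf (act (i + 3) (fun a => (a, MoveLeft)))
       (act (i + 3) (fun=> (Some true, Stay))).

Definition dec (i : nat) : frag :=
  act (i + 3) (fun a => if a is None then (None, Stay) else (None, MoveRight)).

Definition wh (i : nat) (F : frag) : frag := whilef (i + 3) isSome F.

Lemma exec_inc sp r i : exec (inc i) (mk sp r) (mk sp (upd r i (r i).+1)).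
Proof.
apply: exec_eq; first exact: exec_seq (exec_act _ _ _) (exec_act _ _ _).
rewrite -mk_upd; apply: funext => j; rewrite /upd; case: eqP => // _.
rewrite mk_ctr !eqxx awrite_read /= /awrite /=.
by congr pair; apply: funext => -[|k].
Qed.

Lemma exec_dec sp r i : exec (dec i) (mk sp r) (mk sp (upd r i (r i).-1)).
Proof.
apply: exec_eq; first exact: exec_act.
rewrite -mk_upd mk_ctr; congr upd; rewrite /aread /=.
case: (r i) => [|n] /=; congr pair; apply: funext => -[|k] //=.
Qed.

Lemma exec_wh_stop sp r i F : r i = 0 -> exec (wh i F) (mk sp r) (mk sp r).
Proof. by move=> ri; apply: exec_while_stop; rewrite mk_ctr ri. Qed.

Lemma exec_wh_loop sp r i F s s' : 0 < r i -> exec F (mk sp r) s ->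
  exec (wh i F) s s' -> exec (wh i F) (mk sp r) s'.
Proof.
by move=> ri; apply: exec_while_loop; rewrite mk_ctr /aread /= ri.
Qed.

Ltac regs := apply: funext => ?; rewrite /upd /=;
  repeat (case: eqP => //= ?); subst; try lia.

Definition movef (a b : nat) : frag := wh a (seqf (dec a) (inc b)).

Lemma exec_move sp r a b : a != b ->
  exec (movef a b) (mk sp r) (mk sp (upd (upd r b (r b + r a)) a 0)).
Proof.
move=> /eqP ab; move Ek : (r a) => k; elim: k r Ek => [|k IH] r Ek.
  by apply: exec_eq (exec_wh_stop _ _ Ek) _; congr mk; regs.
apply: exec_wh_loop; rewrite ?Ek //.
  exact: exec_seq (exec_dec _ _ _) (exec_inc _ _ _).
apply: exec_eq; first by apply: IH; rewrite /upd; repeat case: eqP => //=; lia.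
by congr mk; regs.
Qed.

Definition move2f (a b c : nat) : frag :=
  wh a (seqf (dec a) (seqf (inc b) (inc c))).

Lemma exec_move2 sp r a b c : a != b -> a != c -> b != c ->
  exec (move2f a b c) (mk sp r)
    (mk sp (upd (upd (upd r b (r b + r a)) c (r c + r a)) a 0)).
Proof.
move=> /eqP ab /eqP ac /eqP bc; move Ek : (r a) => k.
elim: k r Ek => [|k IH] r Ek.
  by apply: exec_eq (exec_wh_stop _ _ Ek) _; congr mk; regs.
apply: exec_wh_loop; rewrite ?Ek //.
  apply: exec_seq (exec_dec _ _ _) _.
  exact: exec_seq (exec_inc _ _ _) (exec_inc _ _ _).
apply: exec_eq; first by apply: IH; rewrite /upd; repeat case: eqP => //=; lia.
by congr mk; regs.
Qed.

Definition copyf (a b c : nat) : frag := seqf (move2f a b c) (movef c a).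

Lemma exec_copy sp r a b c : a != b -> a != c -> b != c -> r b = 0 -> r c = 0 ->
  exec (copyf a b c) (mk sp r) (mk sp (upd r b (r a))).
Proof.
move=> ab ac bc rb rc.
apply: exec_eq.
  apply: exec_seq; first exact: exec_move2.
  by apply: exec_move; rewrite eq_sym.
by move/eqP: ab; move/eqP: ac; move/eqP: bc => *; congr mk; regs.
Qed.

Definition clearf (a : nat) : frag := wh a (dec a).

Lemma exec_clear sp r a : exec (clearf a) (mk sp r) (mk sp (upd r a 0)).
Proof.
move Ek : (r a) => k; elim: k r Ek => [|k IH] r Ek.
  by apply: exec_eq (exec_wh_stop _ _ Ek) _; congr mk; regs.
apply: exec_wh_loop; rewrite ?Ek //; first exact: exec_dec.
apply: exec_eq; first by apply: IH; rewrite /upd eqxx Ek.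
by congr mk; regs.
Qed.

(** * Cantor pairing *)

Fixpoint tri (n : nat) : nat := if n is m.+1 then n + tri m else 0.

Definition pairn (x y : nat) : nat := y + tri (x + y).

(** The successor in the Cantor enumeration: along a diagonal, then to the start of the next one.
    Iterating it from the origin inverts [pairn] without any root extraction. *)
Definition walk (c : nat * nat) : nat * nat :=
  if c.1 is x.+1 then (x, c.2.+1) else (c.2.+1, 0).

Definition unpairn (n : nat) : nat * nat := iter n walk (0, 0).

Lemma pairn_walk c : pairn (walk c).1 (walk c).2 = (pairn c.1 c.2).+1.
Proof.
case: c => -[|x] y; rewrite /pairn /walk /=; last by rewrite addSn addnS /=; lia.
by rewrite addn0 !add0n /=; lia.
Qed.

Lemma unpairnK n : pairn (unpairn n).1 (unpairn n).2 = n.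
Proof. by elim: n => //= n IH; rewrite pairn_walk IH. Qed.

Lemma pairnK x y : unpairn (pairn x y) = (x, y).
Proof.
move En : (pairn x y) => n; elim: n x y En => [|n IH] x y.
  by case: x y => [|x] [|y].
case: y => [|y] E.
  case: x E => [//|x] E; rewrite /= (IH 0 x) //; apply: succn_inj.
  by rewrite -E -(pairn_walk (0, x)).
by rewrite /= (IH x.+1 y) //; apply: succn_inj; rewrite -E -(pairn_walk (x.+1, y)).
Qed.

(** With inputs x and y, the first move leaves x + y in [a] and y in [n]. Every round then adds to
    [n] the value that [a] has before the round and lowers [a] by one, which accumulates
    [tri (x + y)]. *)
Definition pairf (a b n : nat) : frag :=
  seqf (move2f b a n)
    (wh a (seqf (dec a) (seqf (inc n) (seqf (move2f a b n) (movef b a))))).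

Lemma exec_pair sp r a b n : a != b -> a != n -> b != n -> r n = 0 ->
  exec (pairf a b n) (mk sp r)
    (mk sp (upd (upd (upd r a 0) b 0) n (pairn (r a) (r b)))).
Proof.
move=> ab an bn rn.
have loop : forall r, r b = 0 -> exec (wh a (seqf (dec a) (seqf (inc n)
      (seqf (move2f a b n) (movef b a))))) (mk sp r)
    (mk sp (upd (upd r a 0) n (r n + tri (r a)))).
  move=> {rn}r; move Ek : (r a) => k; elim: k r Ek => [|k IH] r Ek rb.
    by apply: exec_eq (exec_wh_stop _ _ Ek) _; congr mk; regs.
  apply: exec_wh_loop; rewrite ?Ek //.
    apply: exec_seq (exec_dec _ _ _) _; apply: exec_seq (exec_inc _ _ _) _.
    apply: exec_seq; first exact: exec_move2.
    by apply: exec_move; rewrite eq_sym.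
  move/eqP: ab; move/eqP: an; move/eqP: bn => bn an ab.
  by apply: exec_eq; first apply: IH; try (congr mk; regs);
    rewrite /upd; repeat (case: eqP => //=); lia.
apply: exec_eq.
  apply: exec_seq; first by apply: exec_move2; rewrite // eq_sym.
  by apply: loop; rewrite upd_same.
by move/eqP: ab; move/eqP: an; move/eqP: bn => *; congr mk; rewrite /pairn; regs.
Qed.

Definition unpairf (n a b : nat) : frag :=
  wh n (seqf (dec n)
    (iff (a + 3) isSome (seqf (dec a) (inc b)) (seqf (inc a) (movef b a)))).

Lemma exec_unpair sp r n a b : a != b -> a != n -> b != n -> r a = 0 -> r b = 0 ->
  exec (unpairf n a b) (mk sp r)
    (mk sp (upd (upd (upd r n 0) a (unpairn (r n)).1) b (unpairn (r n)).2)).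
Proof.
move=> ab an bn ra rb.
(* Arbitrary contents of [a] and [b] are needed for the induction. *)
suff loop : exec (unpairf n a b) (mk sp r)
    (mk sp (upd (upd (upd r n 0) a (iter (r n) walk (r a, r b)).1) b
                                   (iter (r n) walk (r a, r b)).2)).
  by rewrite ra rb in loop.
move: ab an bn {ra rb} => /eqP ab /eqP an /eqP bn.
move Ek : (r n) => k; elim: k r Ek => [|k IH] r Ek.
  by apply: exec_eq (exec_wh_stop _ _ Ek) _; congr mk; regs.
apply: (@exec_wh_loop _ _ _ _
  (mk sp (upd (upd (upd r n k) a (walk (r a, r b)).1) b (walk (r a, r b)).2))).
- by rewrite Ek.
- apply: exec_seq (exec_dec _ _ _) _; apply: exec_if.
  rewrite mk_ctr /aread upd_neq; last by apply/eqP; lia.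
  rewrite /=; case: ltnP => ra /=.
    apply: exec_eq; first exact: exec_seq (exec_dec _ _ _) (exec_inc _ _ _).
    by rewrite /walk /=; congr mk; case Ea: (r a) ra => // _; regs.
  apply: exec_eq.
    apply: exec_seq (exec_inc _ _ _) _; apply: exec_move.
    by rewrite eq_sym; apply/eqP.
  have Ea : r a = 0 by lia.
  by rewrite /walk /= Ea; congr mk; regs.
apply: exec_eq; first by apply: IH; rewrite /upd; repeat (case: eqP => //=); lia.
have Ea : upd (upd (upd r n k) a (walk (r a, r b)).1) b (walk (r a, r b)).2 a
  = (walk (r a, r b)).1 by rewrite /upd; repeat (case: eqP => //=); lia.
rewrite Ea upd_same -surjective_pairing iterSr.
by congr mk; regs.
Qed.

(* The program [p i] acts on counter [i] and may use all counters above it,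
   which are zero before and after. *)
Definition runs (p : nat -> frag) (g : nat -> nat) : Prop :=
  forall sp i r, (forall j, i < j -> r j = 0) ->
  exec (p i) (mk sp r) (mk sp (upd r i (g (r i)))).

Definition natc (g : nat -> nat) : Prop := exists p, runs p g.

Lemma natc_ext g h : g =1 h -> natc g -> natc h.
Proof. by move=> /funext->. Qed.

Lemma natc_succ : natc succn.
Proof. by exists inc => sp i r _; exact: exec_inc. Qed.

Lemma natc_zero : natc (fun=> 0).
Proof. by exists clearf => sp i r _; exact: exec_clear. Qed.

Lemma natc_comp g h : natc g -> natc h -> natc (fun n => g (h n)).
Proof.
move=> [p Hp] [q Hq]; exists (fun i => seqf (q i) (p i)) => sp i r r0.
apply: exec_eq.
  apply: exec_seq; first exact: Hq.
  by apply: Hp => j ij; rewrite upd_neq ?r0 // gtn_eqF.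
by congr mk; rewrite upd_same; regs.
Qed.

(** A program needs zeros in all counters above its own. Hence the value of [g] has to lie below the
    counter on which [h] runs, and between the two calls it changes places with the saved
    argument. *)
Lemma natc_pair g h : natc g -> natc h -> natc (fun n => pairn (g n) (h n)).
Proof.
move=> [p Hp] [q Hq].
exists (fun i => seqf (copyf i i.+1 i.+2) (seqf (p i.+1) (seqf (movef i i.+2)
  (seqf (movef i.+1 i) (seqf (movef i.+2 i.+1) (seqf (q i.+1)
  (seqf (pairf i i.+1 i.+2) (movef i.+2 i)))))))) => sp i r r0.
have r1 : r i.+1 = 0 by apply: r0.
have r2 : r i.+2 = 0 by apply: r0.
have rj j : i.+2 < j -> r j = 0 by move=> ij; apply: r0; lia.
apply: exec_seq; first by apply: exec_copy => //; apply/eqP; lia.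
apply: exec_seq.
  by apply: Hp => j ij; rewrite upd_neq ?r0 //; first lia; apply/eqP; lia.
rewrite upd_same; set gn := g (r i).
apply: exec_seq; first by apply: exec_move; apply/eqP; lia.
apply: exec_seq; first by apply: exec_move; apply/eqP; lia.
apply: exec_seq; first by apply: exec_move; apply/eqP; lia.
set s := (X in exec _ (mk sp X)).
have -> : s = upd (upd r i gn) i.+1 (r i) by rewrite /s; regs.
apply: exec_seq.
  apply: Hq => j ij; rewrite !upd_neq ?r0 //; first lia; apply/eqP; lia.
apply: exec_seq.
  by apply: exec_pair; try (apply/eqP; lia); rewrite /upd; repeat case: eqP; lia.
apply: exec_eq; first by apply: exec_move; apply/eqP; lia.
congr mk; rewrite !upd_same; apply: funext => j; rewrite /upd /=.
have -> : (i == i.+1) = false by apply/eqP; lia.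
have -> : (i == i.+2) = false by apply/eqP; lia.
by rewrite !eqxx /=; repeat (case: eqP => //= ?); subst; try lia.
Qed.

Lemma natc_fst : natc (fun n => (unpairn n).1).
Proof.
exists (fun i => seqf (unpairf i i.+1 i.+2) (seqf (movef i.+1 i) (clearf i.+2))).
move=> sp i r r0.
have r1 : r i.+1 = 0 by apply: r0.
have r2 : r i.+2 = 0 by apply: r0.
apply: exec_seq; first by apply: exec_unpair => //; apply/eqP; lia.
apply: exec_seq; first by apply: exec_move; apply/eqP; lia.
by apply: exec_eq (exec_clear _ _ _) _; congr mk; regs.
Qed.

Lemma natc_snd : natc (fun n => (unpairn n).2).
Proof.
exists (fun i => seqf (unpairf i i.+1 i.+2) (seqf (movef i.+2 i) (clearf i.+1))).
move=> sp i r r0.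
have r1 : r i.+1 = 0 by apply: r0.
have r2 : r i.+2 = 0 by apply: r0.
apply: exec_seq; first by apply: exec_unpair => //; apply/eqP; lia.
apply: exec_seq; first by apply: exec_move; apply/eqP; lia.
by apply: exec_eq (exec_clear _ _ _) _; congr mk; regs.
Qed.

(** The round counter lies below the argument, since the body must run on the topmost counter in
    use. *)
Lemma natc_iter g : natc g -> natc (fun n => iter (unpairn n).1 g (unpairn n).2).
Proof.
move=> [p Hp].
exists (fun i => seqf (unpairf i i.+1 i.+2) (seqf (wh i.+1 (seqf (dec i.+1) (p i.+2)))
   (movef i.+2 i))).
move=> sp i r r0.
have r1 : r i.+1 = 0 by apply: r0.
have r2 : r i.+2 = 0 by apply: r0.
apply: exec_seq; first by apply: exec_unpair => //; apply/eqP; lia.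
case: (unpairn (r i)) => x y /=.
have loop k z : exec (wh i.+1 (seqf (dec i.+1) (p i.+2)))
    (mk sp (upd (upd (upd r i 0) i.+1 k) i.+2 z))
    (mk sp (upd (upd r i 0) i.+2 (iter k g z))).
  elim: k z => [|k IH] z.
    by apply: exec_eq (exec_wh_stop _ _ _) _; last (congr mk; regs);
      rewrite /upd; repeat case: eqP; lia.
  rewrite iterSr; apply: exec_wh_loop (IH (g z)).
    by rewrite /upd; repeat case: eqP; lia.
  apply: exec_seq (exec_dec _ _ _) _; apply: exec_eq.
    by apply: Hp => j ij; rewrite !upd_neq ?r0 //; try (apply/eqP; lia); lia.
  congr mk; apply: funext => j; rewrite /upd /=.
  by repeat (case: eqP => //= ?); subst; try lia.
apply: exec_seq; first exact: loop.
apply: exec_eq; first by apply: exec_move; apply/eqP; lia.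
by congr mk; regs.
Qed.

Lemma natc_id : natc id.
Proof. exact: natc_ext unpairnK (natc_pair natc_fst natc_snd). Qed.

(** * Input, search and output *)

Class coded (T : Type) := Coded { code : T -> nat; code_inj : injective code }.

#[export] Instance coded_nat : coded nat := Coded (fun x y : nat => id).

Lemma bool_code_inj : injective nat_of_bool.
Proof. by do 2!case. Qed.
#[export] Instance coded_bool : coded bool := Coded bool_code_inj.

Section CodedTypes.
Variables (A B : Type) (cA : coded A) (cB : coded B).

Definition code_prod (x : A * B) : nat := pairn (code x.1) (code x.2).

Lemma code_prod_inj : injective code_prod.
Proof.
move=> [a b] [a' b'] /(congr1 unpairn); rewrite /code_prod !pairnK /=.
by case=> /(@code_inj _ cA)-> /(@code_inj _ cB)->.
Qed.

Definition code_option (x : option A) : nat := if x is Some a then (code a).+1 else 0.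

Lemma code_option_inj : injective code_option.
Proof. by case=> [a|] [b|] //= [/(@code_inj _ cA)->]. Qed.

Fixpoint code_seq (l : seq A) : nat :=
  if l is a :: l' then (pairn (code a) (code_seq l')).+1 else 0.

Lemma code_seq_inj : injective code_seq.
Proof.
elim=> [|a l IH] [|b k] //= [] /(congr1 unpairn); rewrite !pairnK.
by case=> /(@code_inj _ cA)-> /IH->.
Qed.

End CodedTypes.

#[export] Instance coded_prod A B (cA : coded A) (cB : coded B) : coded (A * B) :=
  Coded (@code_prod_inj A B cA cB).
#[export] Instance coded_option A (cA : coded A) : coded (option A) :=
  Coded (@code_option_inj A cA).
#[export] Instance coded_seq A (cA : coded A) : coded (seq A) :=
  Coded (@code_seq_inj A cA).

Lemma mk_upd_sp sp r i t : i < 3 -> upd (mk sp r) i t = mk (upd sp i t) r.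
Proof.
by move=> i3; apply: funext => j; rewrite /upd /mk; case: eqP => // ->; rewrite i3.
Qed.

Lemma exec_act_sp i g sp r : i < 3 ->
  exec (act i g) (mk sp r) (mk (upd sp i (amove (g (aread (sp i))).2
                       (awrite (g (aread (sp i))).1 (sp i)))) r).
Proof.
move=> i3; rewrite -mk_upd_sp //; apply: exec_eq (exec_act _ _ _) _.
by rewrite /mk i3.
Qed.

Definition movel (i : nat) : frag := act i (fun a => (a, MoveLeft)).
Definition mover (i : nat) : frag := act i (fun a => (a, MoveRight)).

Lemma exec_mover i sp r : i < 3 ->
  exec (mover i) (mk sp r) (mk (upd sp i (amove MoveRight (sp i))) r).
Proof.
by move=> i3; apply: exec_eq (exec_act_sp _ _ _ i3) _; rewrite awrite_read.
Qed.

Lemma exec_movel i sp r : i < 3 ->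
  exec (movel i) (mk sp r) (mk (upd sp i (amove MoveLeft (sp i))) r).
Proof.
by move=> i3; apply: exec_eq (exec_act_sp _ _ _ i3) _; rewrite awrite_read.
Qed.

Section Read.
Variables pT pF : nat -> frag.
Hypothesis runsT : runs pT (fun n => (pairn 1 n).+1).
Hypothesis runsF : runs pF (fun n => (pairn 0 n).+1).

(** The code of a list is built from its last element, so the head first runs to the end of the
    input and prepends the bits on its way back. *)
Definition readf (i r : nat) : frag :=
  seqf (whilef i isSome (mover i)) (seqf (movel i)
    (whilef i isSome
       (seqf (iff i (fun a => a == Some true) (pT r) (pF r)) (movel i)))).

Lemma exec_to_end i sp r l s : i < 3 ->
  sp i = (nth None l, nth None (map Some s)) ->
  exec (whilef i isSome (mover i)) (mk sp r)
    (mk (upd sp i (nth None (catrev (map Some s) l), fun=> None)) r).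
Proof.
move=> i3; elim: s sp l => [|b s IH] sp l Es.
  apply: exec_eq (exec_while_stop _ _) _; first by rewrite /mk i3 Es.
  congr mk; rewrite -[LHS](upd_id sp i) Es /=; congr (upd _ _ (_, _)).
  by apply: funext => j; rewrite nth_nil.
apply: exec_while_loop; first by rewrite /mk i3 Es.
  exact: exec_mover.
apply: exec_eq; first apply: (IH _ (Some b :: l)).
  by rewrite upd_same Es /=; congr pair; apply: funext => -[].
by rewrite upd_upd.
Qed.

Lemma exec_from_end i k sp r q (l : string) : i < 3 ->
  (exists rt, sp i = amove MoveLeft (nth None (map Some q), rt)) ->
  (forall j, k < j -> r j = 0) -> r k = code l ->
  exists t, exec (whilef i isSome
       (seqf (iff i (fun a => a == Some true) (pT k) (pF k)) (movel i)))
     (mk sp r) (mk (upd sp i t) (upd r k (code (catrev q l)))).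
Proof.
move=> i3; elim: q sp r l => [|b q IH] sp r l [rt Et] rk0 rk.
  exists (sp i); rewrite upd_id [catrev _ _]/= -rk upd_id.
  by apply: exec_while_stop; rewrite /mk i3 Et.
set sp' := upd sp i (amove MoveLeft (sp i)).
set r' := upd r k (code (b :: l)).
have [|||t Ht] := IH sp' r' (b :: l).
- exists (fun j => if j is j'.+1 then rt j' else Some b).
  by rewrite /sp' upd_same Et.
- by move=> j kj; rewrite /r' upd_neq ?rk0 // gtn_eqF.
- by rewrite /r' upd_same.
exists t; apply: exec_eq; first apply: exec_while_loop.
- by rewrite /mk i3 Et.
- apply: exec_seq; last exact: (@exec_movel i sp r').
  apply: exec_if; rewrite {1}/mk i3 Et /= /r'.
  by case: b {IH Et Ht sp' r'}; [have := @runsT sp k r rk0 | have := @runsF sp k r rk0];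
    rewrite rk.
- exact: Ht.
by rewrite /sp' /r' !upd_upd.
Qed.

Lemma exec_read i k sp r s : i < 3 -> sp i = abs (tape_of_string s) ->
  (forall j, k <= j -> r j = 0) ->
  exists t, exec (readf i k) (mk sp r) (mk (upd sp i t) (upd r k (code s))).
Proof.
move=> i3 Es r0.
set sp1 := upd sp i (nth None (map Some (rev s)), fun=> None).
set sp2 := upd sp i (amove MoveLeft (sp1 i)).
have [|||t Ht] := @exec_from_end i k sp2 r (rev s) [::] i3.
- by exists (fun=> None); rewrite /sp2 /sp1 !upd_same.
- by move=> j kj; apply: r0; apply: ltnW.
- by rewrite r0.
exists t; apply: exec_eq; first apply: exec_seq.
- apply: exec_eq; first exact: (@exec_to_end i sp r [::] s).
  by rewrite -/(rev _) -map_rev -/sp1.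
- by apply: exec_seq; [exact: exec_movel|rewrite {1}/sp1 upd_upd; exact: Ht].
by rewrite /sp2 upd_upd -/(rev (rev s)) revK.
Qed.

End Read.

(** Bits are written leftwards, so that the head ends on the first cell of the output, where
    [tm_output] starts reading. This reverses the list, whence [rev z] in [search_machine]. *)
Definition writef (k : nat) : frag :=
  wh k (seqf (dec k) (seqf (unpairf k k.+1 k.+2) (seqf (movel 2)
    (seqf (iff (k.+1 + 3) isSome (act 2 (fun=> (Some true, Stay)))
                            (act 2 (fun=> (Some false, Stay))))
      (seqf (clearf k.+1) (movef k.+2 k)))))).

Lemma exec_write k sp r (l z : string) : (forall j, k < j -> r j = 0) ->
  r k = code l -> sp 2 = abs (tape_of_string z) ->
  exec (writef k) (mk sp r)
     (mk (upd sp 2 (abs (tape_of_string (catrev l z)))) (upd r k 0)).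
Proof.
elim: l sp r z => [|b l IH] sp r z r0 rk Es.
  apply: exec_eq (exec_wh_stop _ _ rk) _.
  rewrite [catrev _ _]/= -Es upd_id; congr mk.
  by apply: funext => j; rewrite /upd; case: eqP => // ->.
have r1 : r k.+1 = 0 by apply: r0.
have r2 : r k.+2 = 0 by apply: r0.
set sp' := upd sp 2 (abs (tape_of_string (b :: z))).
apply: (@exec_wh_loop _ _ _ _ (mk sp' (upd r k (code l)))); first by rewrite rk.
  apply: exec_seq (exec_dec _ _ _) _; rewrite rk.
  apply: exec_seq.
    by apply: exec_unpair; rewrite ?upd_neq //; apply/eqP; lia.
  rewrite upd_same /= pairnK /=.
  apply: exec_seq; first exact: exec_movel.
  apply: exec_seq.
    apply: exec_if; rewrite mk_ctr upd_neq ?upd_same; last by apply/eqP; lia.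
    apply: (@exec_eq _ _ (mk sp' _)) => //.
    have <- : upd (upd sp 2 (amove MoveLeft (sp 2))) 2 (amove Stay
      (awrite (Some b) (amove MoveLeft (sp 2)))) = sp'.
      rewrite upd_upd /sp' Es; congr (upd _ _ (_, _)).
        by apply: funext => j /=; rewrite nth_nil.
      by apply: funext => -[].
    by case: b {IH rk sp'}; apply: exec_eq (exec_act_sp _ _ _ _) _; rewrite // upd_same.
  apply: exec_seq (exec_clear _ _ _) _.
  apply: exec_eq; first by apply: exec_move; apply/eqP; lia.
  by congr mk; regs.
apply: exec_eq; first apply: (IH _ _ (b :: z)).
- by move=> j kj; rewrite upd_neq ?r0 // gtn_eqF.
- by rewrite upd_same.
- by rewrite /sp' upd_same.
by rewrite /sp' !upd_upd.
Qed.

Lemma init_storeE p u : init_store p u = mk (init_store p u) (fun=> 0).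
Proof.
apply: funext => -[|[|[|i]]] //; rewrite /mk /init_store /abs /ctr.
by rewrite nth_default //; congr pair; apply: funext => j; rewrite nth_nil.
Qed.

(** Functions in [natc] are total; the search performed here is the only loop whose length is not
    bounded in advance. *)
Lemma search_machine (st tst nxt out : nat -> nat) :
  natc st -> natc tst -> natc nxt -> natc out ->
  exists V : turing_machine, forall (p u z : string) (k : nat),
    let w j := iter j nxt (st (pairn (code p) (code u))) in
    (forall j, j < k -> tst (w j) <> 0) -> tst (w k) = 0 ->
    out (w k) = code (rev z) -> tm_computes V p u z.
Proof.
move=> [pst Hst] [ptst Htst] [pnxt Hnxt] [pout Hout].
have [pT HT] : natc (fun n => (pairn 1 n).+1).
  apply: (natc_comp (g := succn)) natc_succ _.
  exact: natc_pair (natc_comp natc_succ natc_zero) natc_id.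
have [pF HF] : natc (fun n => (pairn 0 n).+1).
  apply: (natc_comp (g := succn)) natc_succ _.
  exact: natc_pair natc_zero natc_id.
pose test := seqf (copyf 0 1 2) (ptst 1).
exists (compile (seqf (readf pT pF 0 0) (seqf (readf pT pF 1 1)
  (seqf (pairf 0 1 2) (seqf (movef 2 0) (seqf (pst 0) (seqf test
  (seqf (wh 1 (seqf (clearf 1) (seqf (pnxt 0) test))) (seqf (pout 0) (writef 0)))))))))).
move=> p u z k w wlt wk outk.
pose reg a b : nat -> nat := upd (upd (fun=> 0) 0 a) 1 b.
have reg0 a b j : 1 < j -> reg a b j = 0.
  by move=> j1; rewrite /reg !upd_neq //; apply/eqP; lia.
have exec_test sp a : exec test (mk sp (reg a 0)) (mk sp (reg a (tst a))).
  apply: exec_seq; first exact: exec_copy.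
  apply: exec_eq.
    by apply: Htst => j j1; rewrite upd_neq ?reg0 // gtn_eqF.
  by congr mk; rewrite /reg /=; regs.
have [t0 read0] := exec_read HT HF (i := 0) (k := 0) (sp := init_store p u)
  (r := fun=> 0) (s := p) isT erefl (fun _ _ => erefl).
set sp0 := upd _ _ _ in read0.
have [||t1 read1] := exec_read HT HF (i := 1) (k := 1) (sp := sp0)
  (r := upd (fun=> 0) 0 (code p)) (s := u) isT.
- by rewrite /sp0 upd_neq.
- by move=> j j0; rewrite upd_neq // gtn_eqF.
set sp1 := upd sp0 _ _ in read1.
(* Induction on the number [j] of rounds still to be run. *)
have loop j : j <= k -> exec (wh 1 (seqf (clearf 1) (seqf (pnxt 0) test)))
    (mk sp1 (reg (w (k - j)) (tst (w (k - j))))) (mk sp1 (reg (w k) 0)).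
  elim: j => [|j IH] jk.
    apply: exec_eq; first by apply: exec_wh_stop; rewrite subn0 wk.
    by rewrite subn0 wk.
  apply: exec_wh_loop (IH (ltnW jk)).
    by have := wlt (k - j.+1); rewrite /reg upd_same; lia.
  apply: exec_seq (exec_clear _ _ _) _.
  have -> : upd (reg (w (k - j.+1)) (tst (w (k - j.+1)))) 1 0 = reg (w (k - j.+1)) 0.
    by rewrite /reg upd_upd.
  apply: exec_seq.
    by apply: Hnxt => -[//|[|i]] _; rewrite /reg ?upd_same ?reg0.
  have -> : upd (reg (w (k - j.+1)) 0) 0 (nxt (reg (w (k - j.+1)) 0 0)) = reg (w (k - j)) 0.
    have -> : k - j = (k - j.+1).+1 by lia.
    by rewrite /reg /w /=; regs.
  exact: exec_test.
apply: exec_computes.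
- rewrite init_storeE; apply: exec_seq; first exact: read0.
  apply: exec_seq; first exact: read1.
  apply: exec_seq; first exact: exec_pair.
  apply: exec_seq; first exact: exec_move.
  set s := (X in exec _ (mk _ X)).
  have -> : s = reg (pairn (code p) (code u)) 0 by rewrite /s /reg /=; regs.
  apply: exec_seq; first by apply: Hst => -[//|[|i]] _; rewrite /reg ?upd_same ?reg0.
  set s' := (X in exec _ (mk _ X)).
  have -> : s' = reg (w 0) 0 by rewrite /s' /w /reg /=; regs.
  apply: exec_seq; first exact: exec_test.
  apply: exec_seq; first by have := loop k (leqnn _); rewrite subnn; apply.
  apply: exec_seq; first by apply: Hout => -[//|[|i]] _; rewrite /reg ?upd_same ?reg0.
  apply: (exec_write (l := rev z) (z := [::])).
  + by move=> -[//|[|i]] _; rewrite upd_neq // reg0.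
  + by rewrite upd_same.
  + by rewrite /sp1 /sp0 !upd_neq.
by rewrite /= -/(rev (rev z)) revK.
Qed.

(** * Computable functions on coded types *)

(** Nothing is required of [g] off the codes, so a program never has to recognise whether a number
    is a code. *)
Definition cmp (A B : Type) (cA : coded A) (cB : coded B) (f : A -> B) : Prop :=
  exists2 g, natc g & forall a, g (code a) = code (f a).
Arguments cmp {A B cA cB} f.

Lemma natc_cst n : natc (fun=> n).
Proof.
elim: n => [|n IH]; first exact: natc_zero.
exact: natc_comp natc_succ IH.
Qed.

Lemma natc_if b x y : natc b -> natc x -> natc y ->
  natc (fun n => if b n is 0 then y n else x n).
Proof.
move=> Hb Hx Hy.
have Hn : natc (fun n => iter n (fun=> 1) 0).
  apply: natc_ext (natc_comp (natc_iter (natc_cst 1)) (natc_pair natc_id (natc_cst 0))).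
  by move=> n; rewrite pairnK.
(* Overwrites the second component by the first. Applied once to (x, y) if [b n] is positive and not
   at all otherwise, it leaves the selected value in the second component. *)
have Hd : natc (fun n => pairn (unpairn n).1 (unpairn n).1).
  exact: natc_pair natc_fst natc_fst.
apply: natc_ext (natc_comp natc_snd (natc_comp (natc_iter Hd)
  (natc_pair (natc_comp Hn Hb) (natc_pair Hx Hy)))) => n.
by rewrite pairnK /=; case: (b n) => [|[|k]] /=; rewrite !pairnK.
Qed.

Section Computable.
Context {A B C : Type} {cA : coded A} {cB : coded B} {cC : coded C}.

Lemma cmp_ext (f g : A -> B) : f =1 g -> cmp f -> cmp g.
Proof. by move=> /funext->. Qed.

Lemma cmp_id : cmp (fun a : A => a).
Proof. by exists id => //; exact: natc_id. Qed.

Lemma cmp_cst (b : B) : cmp (fun _ : A => b).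
Proof. by exists (fun=> code b) => //; exact: natc_cst. Qed.

Lemma cmp_comp (f : B -> C) (g : A -> B) : cmp f -> cmp g -> cmp (fun a => f (g a)).
Proof.
move=> [f' Hf Ef] [g' Hg Eg]; exists (fun n => f' (g' n)); first exact: natc_comp.
by move=> a; rewrite Eg Ef.
Qed.

Lemma cmp_pair (f : A -> B) (g : A -> C) : cmp f -> cmp g -> cmp (fun a => (f a, g a)).
Proof.
move=> [f' Hf Ef] [g' Hg Eg]; exists (fun n => pairn (f' n) (g' n)).
  exact: natc_pair.
by move=> a; rewrite Ef Eg.
Qed.

Lemma cmp_fst (f : A -> B * C) : cmp f -> cmp (fun a => (f a).1).
Proof.
move=> [f' Hf Ef]; exists (fun n => (unpairn (f' n)).1).
  exact: natc_comp natc_fst Hf.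
by move=> a; rewrite Ef /= pairnK.
Qed.

Lemma cmp_snd (f : A -> B * C) : cmp f -> cmp (fun a => (f a).2).
Proof.
move=> [f' Hf Ef]; exists (fun n => (unpairn (f' n)).2).
  exact: natc_comp natc_snd Hf.
by move=> a; rewrite Ef /= pairnK.
Qed.

Lemma cmp_succ (f : A -> nat) : cmp f -> cmp (fun a => (f a).+1).
Proof.
move=> [f' Hf Ef]; exists (fun n => (f' n).+1); first exact: natc_comp natc_succ Hf.
by move=> a; rewrite Ef.
Qed.

Lemma cmp_iter (f : A -> B -> B) (n : A -> nat) (z : A -> B) :
  cmp (fun q : A * B => f q.1 q.2) -> cmp n -> cmp z ->
  cmp (fun a => iter (n a) (f a) (z a)).
Proof.
move=> [f' Hf Ef] [n' Hn En] [z' Hz Ez].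
pose st k := pairn (unpairn k).1 (f' k).
have Hst : natc st by apply: natc_pair natc_fst Hf.
exists (fun a => (unpairn (iter (n' a) st (pairn a (z' a)))).2).
  apply: natc_ext (natc_comp natc_snd (natc_comp (natc_iter Hst)
    (natc_pair Hn (natc_pair natc_id Hz)))) => a.
  by rewrite pairnK.
move=> a; rewrite En Ez /=.
have -> : iter (n a) st (pairn (code a) (code (z a))) = code (a, iter (n a) (f a) (z a)).
  elim: (n a) => [//|k IH]; rewrite iterS IH /st.
  by rewrite (Ef (a, iter k (f a) (z a))) [code (a, _)]/= pairnK.
by rewrite /= pairnK.
Qed.

Lemma cmp_if (b : A -> bool) (x y : A -> B) : cmp b -> cmp x -> cmp y ->
  cmp (fun a => if b a then x a else y a).
Proof.
move=> [b' Hb Eb] [x' Hx Ex] [y' Hy Ey].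
exists (fun n => if b' n is 0 then y' n else x' n); first exact: natc_if.
by move=> a; rewrite Eb Ex Ey; case: (b a).
Qed.

Lemma cmp_nat_of_bool (b : A -> bool) : cmp b -> cmp (fun a => nat_of_bool (b a)).
Proof. by case=> b' Hb Eb; exists b'. Qed.

Lemma cmp_some (f : A -> B) : cmp f -> cmp (fun a => Some (f a)).
Proof.
move=> [f' Hf Ef]; exists (fun n => (f' n).+1); first exact: natc_comp natc_succ Hf.
by move=> a; rewrite Ef.
Qed.

Lemma cmp_cons (f : A -> B) (g : A -> seq B) : cmp f -> cmp g ->
  cmp (fun a => f a :: g a).
Proof.
move=> [f' Hf Ef] [g' Hg Eg]; exists (fun n => (pairn (f' n) (g' n)).+1).
  exact: natc_comp natc_succ (natc_pair Hf Hg).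
by move=> a; rewrite Ef Eg.
Qed.

End Computable.

(** Kleene's predecessor: the second component lags one step behind the first. *)
Lemma cmp_pred A (cA : coded A) (f : A -> nat) : cmp f -> cmp (fun a => (f a).-1).
Proof.
move=> Hf; pose st (s : nat * nat) := (s.1.+1, s.1).
have E n : iter n st (0, 0) = (n, n.-1) by elim: n => //= n ->.
apply: (@cmp_ext _ _ _ _ (fun a => (iter (f a) st (0, 0)).2)) => [a|].
  by rewrite E.
apply: cmp_snd; apply: (cmp_iter (f := fun=> st)) => //; last exact: cmp_cst.
by apply: cmp_pair; [apply: cmp_succ|]; apply: cmp_fst; apply: cmp_snd; apply: cmp_id.
Qed.

Section Cases.
Context {A B C : Type} {cA : coded A} {cB : coded B} {cC : coded C}.

Lemma cmp_option_case (o : A -> option B) (f : A -> B -> C) (g : A -> C) :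
  cmp o -> cmp (fun q : A * B => f q.1 q.2) -> cmp g ->
  cmp (fun a => if o a is Some b then f a b else g a).
Proof.
move=> [o' Ho Eo] [f' Hf Ef] [g' Hg Eg].
have [p Hp Ep] : cmp (fun n : nat => n.-1) by apply: cmp_pred; exact: cmp_id.
exists (fun n => if o' n is 0 then g' n else f' (pairn n (p (o' n)))).
  apply: natc_if => //; apply: (natc_comp Hf); apply: natc_pair natc_id _.
  exact: natc_comp Hp Ho.
move=> a; rewrite Eo; case: (o a) => [b|] /=; last exact: Eg.
by rewrite (Ep (code b).+1) /= -(Ef (a, b)).
Qed.

End Cases.

Section Lists.
Context {A B C : Type} {cA : coded A} {cB : coded B} {cC : coded C}.

Lemma cmp_seq_case (l : A -> seq B) (f : A -> B -> seq B -> C) (g : A -> C) :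
  cmp l -> cmp (fun q : A * (B * seq B) => f q.1 q.2.1 q.2.2) -> cmp g ->
  cmp (fun a => if l a is b :: l' then f a b l' else g a).
Proof.
move=> [l' Hl El] Hf Hg.
pose o a := if l a is b :: l' then Some (b, l') else None.
(* A list has the same code as the option of its head and tail, so the program for [l] also computes
   [o]. *)
have Ho : cmp o by exists l' => // a; rewrite El /o; case: (l a).
have H := cmp_option_case (f := fun a b => f a b.1 b.2) Ho Hf Hg.
by apply: cmp_ext H => a; rewrite /o; case: (l a).
Qed.

End Lists.

(** Makes the code of a list a bound on the rounds of an iteration that consumes it, as in
    [cmp_foldl]; surplus rounds leave the state unchanged. *)
Lemma size_code_seq A (cA : coded A) (l : seq A) : size l <= code l.
Proof.
elim: l => //= a l IH; rewrite ltnS; apply: leq_trans IH _.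
by rewrite /pairn leq_addr.
Qed.

Ltac projs := repeat (cbv beta; lazymatch goal with
  | |- @cmp _ _ _ _ (fun x => x) => exact cmp_id
  | |- @cmp _ _ _ _ (@fst _ _) => exact (cmp_fst cmp_id)
  | |- @cmp _ _ _ _ (@snd _ _) => exact (cmp_snd cmp_id)
  | |- @cmp _ _ _ _ (fun x => (@?f x, @?g x)) => refine (@cmp_pair _ _ _ _ _ _ f g _ _)
  | |- @cmp _ _ _ _ (fun x => fst (@?f x)) => refine (@cmp_fst _ _ _ _ _ _ f _)
  | |- @cmp _ _ _ _ (fun x => snd (@?f x)) => refine (@cmp_snd _ _ _ _ _ _ f _)
  end).

Section Folds.
Context {A B C : Type} {cA : coded A} {cB : coded B} {cC : coded C}.

Lemma cmp_foldl (f : A -> C -> B -> C) (z : A -> C) (l : A -> seq B) :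
  cmp (fun q : A * (C * B) => f q.1 q.2.1 q.2.2) -> cmp z -> cmp l ->
  cmp (fun a => foldl (f a) (z a) (l a)).
Proof.
move=> Hf Hz [l' Hl El].
pose st a (s : seq B * C) := if s.1 is b :: k then (k, f a s.2 b) else s.
have E a n k c : size k <= n -> iter n (st a) (k, c) = ([::], foldl (f a) c k).
  elim: n k c => [|n IH] [|b k] c // kn; rewrite iterSr; last exact: IH.
  by rewrite /st /= IH.
apply: (@cmp_ext _ _ _ _ (fun a => (iter (code (l a)) (st a) (l a, z a)).2)) => [a|].
  by rewrite E // size_code_seq.
have Hl' : cmp l by exists l'.
apply: cmp_snd; apply: cmp_iter; [|by exists l'|exact: cmp_pair].
apply: cmp_seq_case; [by projs| |by projs].
apply: cmp_pair; first by projs.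
by apply: (cmp_comp (g := fun q : A * (seq B * C) * (B * seq B) =>
  (q.1.1, (q.1.2.2, q.2.1))) Hf); projs.
Qed.

End Folds.

Lemma cmp_rev A B (cA : coded A) (cB : coded B) (l : A -> seq B) :
  cmp l -> cmp (fun a => rev (l a)).
Proof.
move=> Hl.
apply: (@cmp_ext _ _ _ _ (fun a => foldl (fun z x => x :: z) [::] (l a))).
  by move=> a; rewrite /rev; elim: (l a) [::] => //=.
apply: (cmp_foldl (f := fun _ z x => x :: z)) => //; last exact: cmp_cst.
by apply: cmp_cons; projs.
Qed.

Lemma cmp_foldr A B C (cA : coded A) (cB : coded B) (cC : coded C)
    (f : A -> B -> C -> C) (z : A -> C) (l : A -> seq B) :
  cmp (fun q : A * (B * C) => f q.1 q.2.1 q.2.2) -> cmp z -> cmp l ->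
  cmp (fun a => foldr (f a) (z a) (l a)).
Proof.
move=> Hf Hz Hl.
apply: (@cmp_ext _ _ _ _ (fun a => foldl (fun z x => f a x z) (z a) (rev (l a)))).
  by move=> a; rewrite foldl_rev.
apply: (cmp_foldl (f := fun a z x => f a x z)) => //; last exact: cmp_rev.
by apply: (cmp_comp (g := fun q : A * (C * B) => (q.1, (q.2.2, q.2.1))) Hf); projs.
Qed.

(** * Arithmetic and list operations *)

Lemma cmp_addn A (cA : coded A) (f g : A -> nat) : cmp f -> cmp g -> cmp (fun a => f a + g a).
Proof.
move=> Hf Hg; apply: (@cmp_ext _ _ _ _ (fun a => iter (f a) succn (g a))).
  by move=> a; rewrite iter_succn addnC.
by apply: (cmp_iter (f := fun=> succn)) => //; apply: cmp_succ; projs.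
Qed.

Lemma cmp_subn A (cA : coded A) (f g : A -> nat) : cmp f -> cmp g -> cmp (fun a => f a - g a).
Proof.
move=> Hf Hg; apply: (@cmp_ext _ _ _ _ (fun a => iter (g a) predn (f a))).
  by move=> a; rewrite iter_predn.
by apply: (cmp_iter (f := fun=> predn)) => //; apply: cmp_pred; projs.
Qed.

Lemma cmp_expn2 A (cA : coded A) (f : A -> nat) : cmp f -> cmp (fun a => 2 ^ f a).
Proof.
move=> Hf; apply: (@cmp_ext _ _ _ _ (fun a => iter (f a) (fun n => n + n) 1)).
  by move=> a; elim: (f a) => //= n ->; rewrite addnn -mul2n expnS.
apply: (cmp_iter (f := fun _ n => n + n)) => //; last exact: cmp_cst.
by apply: cmp_addn; projs.
Qed.

Lemma cmp_negb A (cA : coded A) (f : A -> bool) : cmp f -> cmp (fun a => ~~ f a).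
Proof.
move=> Hf; apply: (@cmp_ext _ _ _ _ (fun a => if f a then false else true)).
  by move=> a; case: (f a).
by apply: cmp_if => //; apply: cmp_cst.
Qed.

Lemma cmp_andb A (cA : coded A) (f g : A -> bool) : cmp f -> cmp g -> cmp (fun a => f a && g a).
Proof. by move=> Hf Hg; apply: cmp_if => //; apply: cmp_cst. Qed.

Lemma cmp_leq A (cA : coded A) (f g : A -> nat) : cmp f -> cmp g -> cmp (fun a => f a <= g a).
Proof.
move=> Hf Hg.
have [h Hh Eh] := cmp_subn Hf Hg.
exists (fun n => if h n is 0 then 1 else 0).
  by apply: natc_if => //; exact: natc_cst.
by move=> a; rewrite Eh /leq /=; case: (_ - _).
Qed.

Lemma cmp_eq A (cA : coded A) (T : eqType) (cT : coded T) (f g : A -> T) : cmp f -> cmp g ->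
  cmp (fun a => f a == g a).
Proof.
move=> [f' Hf Ef] [g' Hg Eg].
have Hf' : cmp (fun a => code (f a)) by exists f'.
have Hg' : cmp (fun a => code (g a)) by exists g'.
apply: cmp_ext (cmp_andb (cmp_leq Hf' Hg') (cmp_leq Hg' Hf')) => a.
by rewrite -eqn_leq (inj_eq code_inj).
Qed.

Lemma cmp_behead A B (cA : coded A) (cB : coded B)
    (l : A -> seq B) : cmp l -> cmp (fun a => behead (l a)).
Proof.
move=> Hl; apply: (cmp_seq_case (f := fun _ _ k => k)) => //; last exact: cmp_cst.
by projs.
Qed.

Lemma cmp_head A B (cA : coded A) (cB : coded B)
    (x : B) (l : A -> seq B) : cmp l -> cmp (fun a => head x (l a)).
Proof.
move=> Hl; apply: (cmp_seq_case (f := fun _ b _ => b)) => //; last exact: cmp_cst.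
by projs.
Qed.

Lemma cmp_nth A B (cA : coded A) (cB : coded B)
    (x : B) (l : A -> seq B) (n : A -> nat) : cmp l -> cmp n ->
  cmp (fun a => nth x (l a) (n a)).
Proof.
move=> Hl Hn.
apply: (@cmp_ext _ _ _ _ (fun a => head x (iter (n a) behead (l a)))) => [a|].
  elim: (n a) (l a) => [|k IH] k'; first by rewrite nth0.
  by rewrite iterSr IH nth_behead.
apply: cmp_head; apply: (cmp_iter (f := fun=> behead)) => //.
by apply: cmp_behead; projs.
Qed.

Lemma cmp_size A B (cA : coded A) (cB : coded B)
    (l : A -> seq B) : cmp l -> cmp (fun a => size (l a)).
Proof.
move=> Hl; apply: (@cmp_ext _ _ _ _ (fun a => foldr (fun=> succn) 0 (l a))) => [a|].
  by elim: (l a) => //= b k ->.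
apply: (cmp_foldr (f := fun _ _ => succn)) => //; last exact: cmp_cst.
by apply: cmp_succ; projs.
Qed.

Lemma cmp_cat A B (cA : coded A) (cB : coded B)
    (l k : A -> seq B) : cmp l -> cmp k -> cmp (fun a => l a ++ k a).
Proof.
move=> Hl Hk; apply: (@cmp_ext _ _ _ _ (fun a => foldr cons (k a) (l a))) => [a|].
  by elim: (l a) => //= b k' ->.
by apply: (cmp_foldr (f := fun=> cons)) => //; apply: cmp_cons; projs.
Qed.

Lemma cmp_filter A B (cA : coded A) (cB : coded B)
    (p : A -> B -> bool) (l : A -> seq B) :
  cmp (fun q : A * B => p q.1 q.2) -> cmp l ->
  cmp (fun a => [seq b <- l a | p a b]).
Proof.
move=> Hp Hl.
apply: (@cmp_ext _ _ _ _ (fun a =>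
  foldr (fun b k => if p a b then b :: k else k) [::] (l a))) => [a|].
  by elim: (l a) => //= b k ->.
apply: (cmp_foldr (f := fun a b k => if p a b then b :: k else k)) => //;
  last exact: cmp_cst.
apply: cmp_if; [|by apply: cmp_cons; projs|by projs].
by apply: (cmp_comp (g := fun q : A * (B * seq B) => (q.1, q.2.1)) Hp); projs.
Qed.

Lemma cmp_has A B (cA : coded A) (cB : coded B)
    (p : A -> B -> bool) (l : A -> seq B) :
  cmp (fun q : A * B => p q.1 q.2) -> cmp l -> cmp (fun a => has (p a) (l a)).
Proof.
move=> Hp Hl.
apply: (@cmp_ext _ _ _ _ (fun a => 0 < size (filter (p a) (l a)))) => [a|].
  by rewrite size_filter has_count.
by apply: cmp_leq; [exact: cmp_cst|apply: cmp_size; exact: cmp_filter].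
Qed.

Lemma cmp_all A B (cA : coded A) (cB : coded B)
    (p : A -> B -> bool) (l : A -> seq B) :
  cmp (fun q : A * B => p q.1 q.2) -> cmp l -> cmp (fun a => all (p a) (l a)).
Proof.
move=> Hp Hl.
apply: (@cmp_ext _ _ _ _ (fun a => ~~ has (fun b => ~~ p a b) (l a))) => [a|].
  by rewrite -all_predC; apply: eq_all => b /=; rewrite negbK.
by apply: cmp_negb; apply: cmp_has => //; apply: cmp_negb.
Qed.

Lemma cmp_count A B (cA : coded A) (cB : coded B)
    (p : A -> B -> bool) (l : A -> seq B) :
  cmp (fun q : A * B => p q.1 q.2) -> cmp l -> cmp (fun a => count (p a) (l a)).
Proof.
move=> Hp Hl.
apply: (@cmp_ext _ _ _ _ (fun a => size (filter (p a) (l a)))) => [a|].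
  by rewrite size_filter.
by apply: cmp_size; exact: cmp_filter.
Qed.

Lemma cmp_map A B C (cA : coded A) (cB : coded B) (cC : coded C)
    (f : A -> B -> C) (l : A -> seq B) :
  cmp (fun q : A * B => f q.1 q.2) -> cmp l -> cmp (fun a => map (f a) (l a)).
Proof.
move=> Hf Hl.
apply: (cmp_foldr (f := fun a b k => f a b :: k)) => //; last exact: cmp_cst.
apply: cmp_cons; last by projs.
by apply: (cmp_comp (g := fun q : A * (B * seq C) => (q.1, q.2.1)) Hf); projs.
Qed.

Lemma cmp_pmap A B C (cA : coded A) (cB : coded B) (cC : coded C)
    (f : A -> B -> option C) (l : A -> seq B) :
  cmp (fun q : A * B => f q.1 q.2) -> cmp l -> cmp (fun a => pmap (f a) (l a)).
Proof.
move=> Hf Hl.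
apply: (@cmp_ext _ _ _ _ (fun a =>
  foldr (fun b k => if f a b is Some c then c :: k else k) [::] (l a))) => [a|].
  by elim: (l a) => //= b k ->; case: (f a b).
apply: (cmp_foldr (f := fun a b k => if f a b is Some c then c :: k else k)) => //;
  last exact: cmp_cst.
apply: cmp_option_case; last by projs.
  by apply: (cmp_comp (g := fun q : A * (B * seq C) => (q.1, q.2.1)) Hf); projs.
by apply: cmp_cons; projs.
Qed.

Lemma cmp_mem A (cA : coded A) (T : eqType) (cT : coded T) (x : A -> T)
    (l : A -> seq T) : cmp x -> cmp l -> cmp (fun a => x a \in l a).
Proof.
move=> Hx Hl; apply: (@cmp_ext _ _ _ _ (fun a => has (fun y => x a == y) (l a))) => [a|].
  by rewrite -[x a \in l a]has_pred1; apply: eq_has => y /=; rewrite eq_sym.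
apply: cmp_has => //; apply: cmp_eq; last by projs.
by apply: (cmp_comp Hx); projs.
Qed.

Lemma cmp_undup A (cA : coded A) (T : eqType) (cT : coded T) (l : A -> seq T) :
  cmp l -> cmp (fun a => undup (l a)).
Proof.
move=> Hl; apply: (@cmp_ext _ _ _ _ (fun a =>
  foldr (fun b k => if b \in k then k else b :: k) [::] (l a))) => [a|].
  by elim: (l a) => //= b k ->; rewrite mem_undup.
apply: (cmp_foldr (f := fun _ (b : T) k => if b \in k then k else b :: k)) => //;
  last exact: cmp_cst.
apply: cmp_if; first by apply: cmp_mem; projs.
  by projs.
by apply: cmp_cons; projs.
Qed.

Lemma cmp_iota0 A (cA : coded A) (n : A -> nat) : cmp n -> cmp (fun a => iota 0 (n a)).
Proof.
move=> Hn; apply: (@cmp_ext _ _ _ _ (fun a => iter (n a) (fun s : seq nat => s ++ [:: size s]) [::])).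
  move=> a; elim: (n a) => [//|k IH].
  by rewrite -addn1 iotaD addn1 /= IH size_iota.
apply: (cmp_iter (f := fun _ (s : seq nat) => s ++ [:: size s])) => //; last exact: cmp_cst.
apply: cmp_cat; first by projs.
by apply: cmp_cons; [apply: cmp_size; projs|exact: cmp_cst].
Qed.

(** * Simulation of Turing machines *)

(** A hook of [cmp_step], redefined whenever further operations have been shown computable. *)
Ltac cmp_user := fail.

Ltac cmp_hyp := match goal with
  | H : @cmp _ _ _ _ ?h |- @cmp _ _ _ _ ?h => exact H
  | H : @cmp _ _ _ _ ?h |- @cmp _ _ _ _ (fun x => ?h (@?f x)) =>
      refine (@cmp_comp _ _ _ _ _ _ h f H _)
  end.

Ltac cmp_step := cbv beta; lazymatch goal with
  | |- @cmp _ _ _ _ (fun x => x) => exact cmp_id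
  | |- @cmp _ _ _ _ (fun _ => ?b) => exact (cmp_cst b)
  | |- @cmp _ _ _ _ (@fst _ _) => exact (cmp_fst cmp_id)
  | |- @cmp _ _ _ _ (@snd _ _) => exact (cmp_snd cmp_id)
  | |- @cmp _ _ _ _ (fun x => (@?f x, @?g x)) => refine (@cmp_pair _ _ _ _ _ _ f g _ _)
  | |- @cmp _ _ _ _ (fun x => fst (@?f x)) => refine (@cmp_fst _ _ _ _ _ _ f _)
  | |- @cmp _ _ _ _ (fun x => snd (@?f x)) => refine (@cmp_snd _ _ _ _ _ _ f _)
  | |- @cmp _ _ _ _ (fun x => S (@?f x)) => refine (@cmp_succ _ _ f _)
  | |- @cmp _ _ _ _ (fun x => Some (@?f x)) => refine (@cmp_some _ _ _ _ f _)
  | |- @cmp _ _ _ _ (fun x => addn (@?f x) (@?g x)) => refine (@cmp_addn _ _ f g _ _)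
  | |- @cmp _ _ _ _ (fun x => subn (@?f x) (@?g x)) => refine (@cmp_subn _ _ f g _ _)
  | |- @cmp _ _ _ _ (fun x => predn (@?f x)) => refine (@cmp_pred _ _ f _)
  | |- @cmp _ _ _ _ (fun x => expn 2 (@?f x)) => refine (@cmp_expn2 _ _ f _)
  | |- @cmp _ _ _ _ (fun x => leq (@?f x) (@?g x)) => refine (@cmp_leq _ _ f g _ _)
  | |- @cmp _ _ _ _ (fun x => eq_op (@?f x) (@?g x)) => refine (@cmp_eq _ _ _ _ f g _ _)
  | |- @cmp _ _ _ _ (fun x => negb (@?f x)) => refine (@cmp_negb _ _ f _)
  | |- @cmp _ _ _ _ (fun x => andb (@?f x) (@?g x)) => refine (@cmp_andb _ _ f g _ _)
  | |- @cmp _ _ _ _ (fun x => nat_of_bool (@?f x)) => refine (@cmp_nat_of_bool _ _ f _)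
  | |- @cmp _ _ _ _ (fun x => cons (@?f x) (@?g x)) => refine (@cmp_cons _ _ _ _ f g _ _)
  | |- @cmp _ _ _ _ (fun x => behead (@?f x)) => refine (@cmp_behead _ _ _ _ f _)
  | |- @cmp _ _ _ _ (fun x => head ?d (@?f x)) => refine (@cmp_head _ _ _ _ d f _)
  | |- @cmp _ _ _ _ (fun x => nth ?d (@?f x) (@?g x)) => refine (@cmp_nth _ _ _ _ d f g _ _)
  | |- @cmp _ _ _ _ (fun x => size (@?f x)) => refine (@cmp_size _ _ _ _ f _)
  | |- @cmp _ _ _ _ (fun x => cat (@?f x) (@?g x)) => refine (@cmp_cat _ _ _ _ f g _ _)
  | |- @cmp _ _ _ _ (fun x => rev (@?f x)) => refine (@cmp_rev _ _ _ _ f _)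
  | |- @cmp _ _ _ _ (fun x => filter (@?p x) (@?l x)) => refine (@cmp_filter _ _ _ _ p l _ _)
  | |- @cmp _ _ _ _ (fun x => has (@?p x) (@?l x)) => refine (@cmp_has _ _ _ _ p l _ _)
  | |- @cmp _ _ _ _ (fun x => all (@?p x) (@?l x)) => refine (@cmp_all _ _ _ _ p l _ _)
  | |- @cmp _ _ _ _ (fun x => count (@?p x) (@?l x)) => refine (@cmp_count _ _ _ _ p l _ _)
  | |- @cmp _ _ _ _ (fun x => map (@?p x) (@?l x)) => refine (@cmp_map _ _ _ _ _ _ p l _ _)
  | |- @cmp _ _ _ _ (fun x => pmap (@?p x) (@?l x)) => refine (@cmp_pmap _ _ _ _ _ _ p l _ _)
  | |- @cmp _ _ _ _ (fun x => undup (@?l x)) => refine (@cmp_undup _ _ _ _ l _)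
  | |- @cmp _ _ _ _ (fun x => iota 0 (@?l x)) => refine (@cmp_iota0 _ _ l _)
  | |- @cmp _ _ _ _ (fun x => iter (@?n x) (@?f x) (@?z x)) =>
      refine (@cmp_iter _ _ _ _ f n z _ _ _)
  | |- @cmp _ _ _ _ (fun x => foldl (@?f x) (@?z x) (@?l x)) =>
      refine (@cmp_foldl _ _ _ _ _ _ f z l _ _ _)
  | |- @cmp _ _ _ _ (fun x => foldr (@?f x) (@?z x) (@?l x)) =>
      refine (@cmp_foldr _ _ _ _ _ _ f z l _ _ _)
  | |- @cmp _ _ _ _ (fun x => in_mem (@?f x) (mem (@?l x))) =>
      refine (@cmp_mem _ _ _ _ f l _ _)
  | |- @cmp _ _ _ _ (fun x => match @?b x with true => @?f x | false => @?g x end) =>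
      refine (@cmp_if _ _ _ _ b f g _ _ _)
  | |- @cmp _ _ _ _ (fun x => match @?o x with Some y => @?f x y | None => @?g x end) =>
      refine (@cmp_option_case _ _ _ _ _ _ o f g _ _ _)
  | |- _ => first [cmp_hyp | cmp_user]
  end.

Ltac cmp_tac := repeat cmp_step.

Section Simulation.
Variable M : turing_machine.

Let N := (tm_work M).+3.

Definition config : Type := (nat * seq tape)%type.

Definition move_code (m : head_move) : nat :=
  match m with MoveLeft => 0 | MoveRight => 1 | Stay => 2 end.

Definition rank_of (q : tm_state M) : nat := enum_rank q.

Definition halting : seq nat := [seq rank_of q | q <- enum (tm_state M) & tm_halt q].

(** The transition function has a finite graph; as an explicit list it is a constant and thereby
    computable. *)
Definition table : seq ((nat * seq symbol) * (nat * seq (symbol * nat))) :=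
  [seq ((rank_of k.1, tval k.2),
        (rank_of (tm_delta k.1 k.2).1,
         [seq (d.1, move_code d.2) | d <- tval (tm_delta k.1 k.2).2]))
  | k <- enum {: tm_state M * N.-tuple symbol}].

Definition lookup (k : nat * seq symbol) : nat * seq (symbol * nat) :=
  foldr (fun e r => if k == e.1 then e.2 else r) (0, [::]) table.

Definition act_on (d : symbol * nat) (t : tape) : tape :=
  if d.2 == 0 then (behead t.1, head None t.1 :: d.1 :: behead t.2)
  else if d.2 == 1 then (d.1 :: t.1, behead t.2)
  else (t.1, d.1 :: behead t.2).

Definition cstep (c : config) : config :=
  if c.1 \in halting then c else
  ((lookup (c.1, map (fun t => head None t.2) c.2)).1,
   [seq act_on (nth (None, 0) (lookup (c.1, map (fun t => head None t.2) c.2)).2 i)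
               (nth ([::], [::]) c.2 i) | i <- iota 0 N]).

Definition cinit (p u : string) : config :=
  (rank_of (tm_start M),
   [seq ([::], map Some (nth [::] [:: p; u] i)) | i <- iota 0 N]).

Definition coutput (c : config) : string :=
  foldr (fun a z => if a is Some b then b :: z else [::]) [::]
    (nth ([::], [::]) c.2 2).2.

Definition run (s : nat) (p u : string) : option string :=
  if (iter s cstep (cinit p u)).1 \in halting
  then Some (coutput (iter s cstep (cinit p u))) else None.

Lemma cmp_lookup A (cA : coded A) (k : A -> nat * seq symbol) :
  cmp k -> cmp (fun a => lookup (k a)).
Proof. by move=> Hk; rewrite /lookup; cmp_tac. Qed.

Lemma cmp_cstep : cmp cstep.
Proof.
have Hr : cmp (fun c : config => map (fun t : tape => head None t.2) c.2) by cmp_tac.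
have Hl : cmp lookup by apply: (cmp_lookup (k := id)); cmp_tac.
by rewrite /cstep /act_on; cmp_tac.
Qed.

(** With the number of steps as an argument, simulation is a total function although [M] may fail to
    halt. *)
Lemma cmp_run A (cA : coded A) (s : A -> nat) (p u : A -> string) :
  cmp s -> cmp p -> cmp u -> cmp (fun a => run (s a) (p a) (u a)).
Proof.
move=> Hs Hp Hu; have Hc := cmp_cstep.
have Hi : cmp (fun a => cinit (p a) (u a)) by rewrite /cinit; cmp_tac.
by rewrite /run /coutput; cmp_tac.
Qed.

Definition encode_config (c : tm_config M) : config := (rank_of c.1, tval c.2).

Lemma halting_rank q : (rank_of q \in halting) = tm_halt q.
Proof.
apply/mapP/idP => [[q' + /val_inj/enum_rank_inj->]|hq]; first by rewrite mem_filter => /andP[].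
by exists q => //; rewrite mem_filter hq mem_enum.
Qed.

Lemma lookupE q (r : N.-tuple symbol) :
  lookup (rank_of q, tval r) = (rank_of (tm_delta q r).1,
     [seq (d.1, move_code d.2) | d <- tval (tm_delta q r).2]).
Proof.
rewrite /lookup /table.
have: (q, r) \in enum {: tm_state M * N.-tuple symbol} by rewrite mem_enum.
elim: (enum _) => //= -[q' r'] l IH; rewrite inE.
case: ((q, r) =P (q', r')) => [[-> ->] _|ne /= ql]; first by rewrite eqxx.
rewrite ifN ?IH //; apply/eqP => -[/val_inj/enum_rank_inj eq_q /val_inj eq_r].
by apply: ne; rewrite eq_q eq_r.
Qed.

Lemma cstep_encode c : cstep (encode_config c) = encode_config (tm_step c).
Proof.
case: c => q ts; rewrite /cstep /tm_step /encode_config [(_, _).1]/= [(_, _).2]/=.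
rewrite halting_rank ![(q, ts).1]/=; case: ifP => // _.
have := lookupE q [tuple of map tape_read ts].
rewrite [tval [tuple of _]]/= [X in map X]/tape_read => ->.
rewrite ![(_, _).1]/= ![(_, _).2]/=; congr pair.
move: (tm_delta q _).2 => D.
apply: (@eq_from_nth _ ([::], [::])); first by rewrite size_map size_iota [RHS]size_tuple.
move=> i; rewrite size_map size_iota => iN.
rewrite (nth_map 0) ?size_iota // nth_iota // add0n.
pose o := Ordinal iN; rewrite -[i]/(val o) -[RHS]tnth_nth tnth_mktuple.
rewrite (nth_map (None, Stay)) ?size_tuple // -!tnth_nth.
by case: (tnth D o) => a [].
Qed.

Lemma cinit_encode p u : cinit p u = encode_config (tm_init M p u).
Proof.
by rewrite /cinit -val_enum_ord -map_comp.
Qed.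

Lemma coutput_encode c : coutput (encode_config c) = tm_output c.
Proof.
rewrite /coutput /tm_output /=; elim: (nth _ _ _).2 => //= -[b|] r IH //=.
by rewrite IH.
Qed.

Lemma runE s p u : run s p u =
  let c := iter s (@tm_step M) (tm_init M p u) in
  if tm_halt c.1 then Some (tm_output c) else None.
Proof.
have E : iter s cstep (cinit p u) = encode_config (iter s (@tm_step M) (tm_init M p u)).
  by rewrite cinit_encode; elim: s => //= s ->; rewrite cstep_encode.
by rewrite /run E /= halting_rank coutput_encode.
Qed.

Lemma tm_computesP p u z : tm_computes M p u z <-> exists s, run s p u = Some z.
Proof.
split=> -[s]; rewrite ?runE /=; first by case=> h <-; exists s; rewrite runE /= h.
by case: ifP => // h [<-]; exists s.
Qed.

Lemma run_mono s s' p u z : s <= s' -> run s p u = Some z -> run s' p u = Some z.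
Proof.
move=> /subnK<-; elim: (s' - s) => // k IH /IH; rewrite !runE /= => {IH}.
by case: ifP => // h [<-]; rewrite /tm_step h h.
Qed.

End Simulation.

(** * Enumerations and descriptions *)

Lemma mu_machine (tst : (string * string) * nat -> bool)
    (out : (string * string) * nat -> string) :
  cmp tst -> cmp out ->
  exists V : turing_machine, forall p u k, tst ((p, u), k) ->
    (forall j, j < k -> ~~ tst ((p, u), j)) ->
    tm_computes V p u (out ((p, u), k)).
Proof.
move=> Htst Hout.
have [tst' Ht Et] : cmp (fun q => ~~ tst q) by cmp_tac.
have [nxt Hn En] : cmp (fun q : (string * string) * nat => (q.1, q.2.+1)) by cmp_tac.
have [out' Ho Eo] : cmp (fun q => rev (out q)) by cmp_tac.
have Hs : natc (fun n => pairn n 0) by apply: natc_pair natc_id natc_zero.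
have [V HV] := search_machine Hs Ht Hn Ho; exists V => p u k tk tj.
have w j : iter j nxt (pairn (pairn (code p) (code u)) 0) = code ((p, u), j).
  by elim: j => // j IH; rewrite iterS IH En.
apply: (HV p u _ k) => [j jk| |]; rewrite w ?Et ?Eo //.
  by rewrite tj.
by rewrite tk.
Qed.

(** Inverse of [nat_string]: the initial 1 is the suppressed leading digit, and the predecessor
    undoes the shift by one. *)
Definition val_string (s : string) : nat :=
  (foldr (fun (b : bool) n => n + n + b) 1 s).-1.

Lemma foldr_bits_gt0 s : 0 < foldr (fun (b : bool) n => n + n + b) 1 s.
Proof. by elim: s => //= b s IH; lia. Qed.

Lemma val_stringS s : (val_string s).+1 = foldr (fun (b : bool) n => n + n + b) 1 s.
Proof. by rewrite /val_string prednK // foldr_bits_gt0. Qed.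

Lemma val_nat_string i : val_string (nat_string i) = i.
Proof.
apply: succn_inj; rewrite val_stringS /nat_string.
have E p : foldr (fun (b : bool) n => n + n + b) 1 (pos_string p) = Pos.to_nat p.
  by elim: p => [p IH|p IH|] //=; rewrite IH; lia.
by rewrite E; lia.
Qed.

Lemma val_string_inj : injective val_string.
Proof.
move=> s t /(congr1 succn); rewrite !val_stringS.
elim: s t => [|b s IH] [|c t] //=.
- by have := foldr_bits_gt0 t; lia.
- by have := foldr_bits_gt0 s; lia.
move=> E; have bc : b = c by case: b c E => -[] /=; lia.
by rewrite bc (IH t) //; move: E; rewrite bc; lia.
Qed.

Lemma expn_size_val s : 2 ^ size s <= (val_string s).+1.
Proof. by rewrite val_stringS; elim: s => //= b s IH; rewrite expnS; lia. Qed.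

Lemma size_nat_string i k : i < 2 ^ k -> size (nat_string i) <= k.
Proof.
move=> ik; rewrite -(leq_exp2l (m := 2)) //.
by apply: leq_trans (expn_size_val _) _; rewrite val_nat_string.
Qed.

Definition dbl (s : string) : string :=
  flatten [seq [:: b; b] | b <- s] ++ [:: false; true].

Lemma size_dbl s : size (dbl s) = (2 * size s).+2.
Proof. by rewrite /dbl size_cat /=; elim: s => //= b s; lia. Qed.

Definition split_step (st : (string * string) * bool) : (string * string) * bool :=
  if st.2 then st
  else if nth false st.1.2 0 == nth false st.1.2 1
  then ((nth false st.1.2 0 :: st.1.1, behead (behead st.1.2)), false)
  else ((st.1.1, behead (behead st.1.2)), true).

(** The length serves as fuel: each step removes two bits until the closing 01 sets the flag, after
    which nothing changes. *)
Definition split1 (s : string) : string * string :=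
  (rev (iter (size s) split_step (([::], s), false)).1.1,
   (iter (size s) split_step (([::], s), false)).1.2).

Arguments split1 : simpl never.

Lemma split1_dbl s r : split1 (dbl s ++ r) = (s, r).
Proof.
have E acc n : size s < n ->
    iter n split_step ((acc, dbl s ++ r), false) = ((rev s ++ acc, r), true).
  elim: s acc n => [|b s IH] acc [|n] // sn; rewrite iterSr.
    have -> : split_step ((acc, dbl [::] ++ r), false) = ((acc, r), true) by [].
    by elim: n {sn} => //= n ->.
  by rewrite /split_step /= eqxx IH // rev_cons cat_rcons.
by rewrite /split1 E ?cats0 ?revK // size_cat size_dbl; lia.
Qed.

Definition parse_step (st : seq string * string) : seq string * string :=
  if st.2 == [::] then st
  else ((split1 st.2).1 :: st.1, (split1 st.2).2).

Definition parse_seq (s : string) : seq string :=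
  rev (iter (size s) parse_step ([::], s)).1.

Lemma parse_seqK l : parse_seq (enc_seq l) = l.
Proof.
have E acc n : size l <= n ->
    iter n parse_step (acc, enc_seq l) = (rev l ++ acc, [::]).
  elim: l acc n => [|s l IH] acc n; first by elim: n => //= n IH _; rewrite IH.
  case: n => // n ln; rewrite iterSr.
  have -> : enc_seq (s :: l) = dbl s ++ enc_seq l by [].
  rewrite {2}/parse_step split1_dbl /= ifN; last by case: (s).
  by rewrite IH // rev_cons cat_rcons.
rewrite /parse_seq E ?cats0 ?revK //; elim: l {E} => // s l IH.
have -> : enc_seq (s :: l) = dbl s ++ enc_seq l by [].
by rewrite size_cat size_dbl [size (s :: l)]/=; lia.
Qed.

Section ParseComputable.
Context {A : Type} {cA : coded A}.

Lemma cmp_val_string (f : A -> string) : cmp f -> cmp (fun a => val_string (f a)).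
Proof. by move=> Hf; rewrite /val_string; cmp_tac. Qed.

Lemma cmp_split1 (f : A -> string) : cmp f -> cmp (fun a => split1 (f a)).
Proof. by move=> Hf; rewrite /split1 /split_step; cmp_tac. Qed.

End ParseComputable.

Lemma cmp_parse A (cA : coded A) (f : A -> string) : cmp f -> cmp (fun a => parse_seq (f a)).
Proof.
move=> Hf; have Hs : cmp split1 by apply: (cmp_split1 (f := id)); cmp_tac.
by rewrite /parse_seq /parse_step; cmp_tac.
Qed.

Fixpoint decode_fuel (k n : nat) : seq nat :=
  if k is k'.+1 then
    if n is m.+1 then (unpairn m).1 :: decode_fuel k' (unpairn m).2 else [::]
  else [::].

Definition decode (n : nat) : seq nat := decode_fuel n n.

(** On lists of numbers [code] is onto, so that [decode] is realised by the identity program. *)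
Lemma decodeK n : code (decode n) = n.
Proof.
rewrite /decode; have : n <= n by [].
move: {2 3}n => k; elim: k n => [|k IH] [|n] //; rewrite ltnS => nk /=.
congr S; rewrite -{3}(unpairnK n); congr pairn; apply: IH.
by apply: leq_trans nk; rewrite -{2}(unpairnK n) /pairn leq_addr.
Qed.

(** A surjection onto all pairs of a stage and a string, which dovetails the search over both. *)
Definition entry (n : nat) : nat * string :=
  ((unpairn n).1, [seq i == 1 | i <- decode (unpairn n).2]).

Lemma entry_onto s z : entry (pairn s (code z)) = (s, z).
Proof.
rewrite /entry pairnK; congr pair => /=.
have -> : decode (code z) = map nat_of_bool z.
  apply: (code_inj (coded := coded_seq coded_nat)).
  by rewrite decodeK; elim: z => //= b z ->.
by rewrite -map_comp map_id_in // => -[].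
Qed.

Lemma cmp_entry A (cA : coded A) (f : A -> nat) : cmp f -> cmp (fun a => entry (f a)).
Proof.
move=> Hf.
have Hd : cmp decode by exists id; [exact: natc_id|move=> n; rewrite decodeK].
have Hu : cmp unpairn by exists id; [exact: natc_id|move=> n; rewrite /= /code_prod unpairnK].
by rewrite /entry; cmp_tac.
Qed.

Lemma KC_le U p u z : tm_computes U p u z -> KC U z u <= size p.
Proof.
move=> Hp; rewrite /KC; have Hk : has_program U z u (size p) by apply/asboolP; exists p.
case: pselect => [ex|[]]; last by exists (size p).
by case: ex_minnP => k _; apply.
Qed.

Lemma KC_program U z u p : tm_computes U p u z ->
  exists2 q, size q = KC U z u & tm_computes U q u z.
Proof.
move=> Hp; rewrite /KC; have Hk : has_program U z u (size p) by apply/asboolP; exists p.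
case: pselect => [ex|[]]; last by exists (size p).
by case: ex_minnP => k /asboolP.
Qed.

(* A program consists of the self-delimited parameter [q] and the index of [z]
   in the enumeration of the set [{z | exists s, D q u s z}]. *)
Lemma description (U : turing_machine) (D : (nat * string) * (nat * string) -> bool) :
  universal U -> cmp D ->
  exists c, forall q u z k, (exists s, D ((q, u), (s, z))) ->
    (forall l : seq string, uniq l ->
       {in l, forall z', exists s, D ((q, u), (s, z'))} -> size l <= 2 ^ k) ->
    KC U z u <= k + 2 * size (nat_string q) + c.
Proof.
move=> hU HD.
pose hit (e : nat * string) n := D (e, entry n).
(* Only the first hit of each string counts, so that counting these hits numbers distinct
   strings. *)
pose new e n := hit e n &&
  ~~ has (fun m => hit e m && ((entry m).2 == (entry n).2)) (iota 0 n).
pose param (q : (string * string) * nat) := (val_string (split1 q.1.1).1, q.1.2).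
pose tst q := new (param q) q.2 &&
  (count (new (param q)) (iota 0 q.2) == val_string (split1 q.1.1).2).
have Hs : cmp split1 by apply: (cmp_split1 (f := id)); cmp_tac.
have Hv : cmp val_string by apply: (cmp_val_string (f := id)); cmp_tac.
have He : cmp entry by apply: (cmp_entry (f := id)); cmp_tac.
have Hp : cmp param by rewrite /param; cmp_tac.
have Hnew : cmp (fun a : (nat * string) * nat => new a.1 a.2).
  by rewrite /new /hit; cmp_tac.
have Hn' : cmp (fun a : ((string * string) * nat) * nat => new (param a.1) a.2).
  by apply: (cmp_comp (g := fun a : ((string * string) * nat) * nat => (param a.1, a.2)) Hnew);
    cmp_tac.
have Htst : cmp tst.
  rewrite /tst; cmp_tac => //.
  by apply: (cmp_comp (g := fun a : ((string * string) * nat) => (a, a.2)) Hn'); cmp_tac.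
have Hout : cmp (fun q : (string * string) * nat => (entry q.2).2) by cmp_tac.
have [V HV] := mu_machine Htst Hout.
(* [dbl] doubles the parameter and appends two bits: hence the factor 2 in the bound and the 2
   here. *)
have [c Hc] := hU V; exists (2 + c) => q u z k [s Ds] bnd.
have ex : exists n, hit (q, u) n && ((entry n).2 == z).
  by exists (pairn s (code z)); rewrite /hit entry_onto Ds eqxx.
case: (ex_minnP ex) => n /andP[hn /eqP nz] nmin.
have newn : new (q, u) n.
  rewrite /new hn nz; apply/hasPn => m; rewrite mem_iota add0n => /andP[_ mn].
  by apply: contraL mn => /nmin; rewrite -leqNgt.
set i := count (new (q, u)) (iota 0 n).
pose p := dbl (nat_string q) ++ nat_string i.
have Vp : tm_computes V p u z.
  have sp : split1 p = (nat_string q, nat_string i) by exact: split1_dbl.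
  have parp m : param ((p, u), m) = (q, u) by rewrite /param sp val_nat_string.
  rewrite -nz; apply: (HV p u n).
    by rewrite /tst parp newn sp val_nat_string /= eqxx.
  move=> j jn; rewrite /tst parp sp val_nat_string.
  (* A new hit at [j < n] preceded by exactly [i] new hits would raise the count below [n] above
     [i]. *)
  apply/negP => /andP[newj /eqP Ej].
  have : count (new (q, u)) (iota 0 j.+1) <= i.
    by rewrite /i -(subnKC jn) iotaD count_cat leq_addr.
  by rewrite -addn1 iotaD count_cat Ej /= add0n newj; lia.
have [w sw Uw] := Hc _ _ _ Vp.
apply: leq_trans (KC_le Uw) _; apply: leq_trans sw _.
have ik : i < 2 ^ k.
  (* The strings numbered up to and including [z] are distinct elements of the set, so
     [i.+1 <= 2 ^ k] and the index [i] fits into [k] bits. *)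
  pose l := [seq (entry m).2 | m <- iota 0 n.+1 & new (q, u) m].
  have -> : i.+1 = size l.
    by rewrite size_map size_filter -[in RHS]addn1 iotaD count_cat /= add0n newn addn1.
  apply: bnd.
    rewrite map_inj_in_uniq ?filter_uniq ?iota_uniq // => m m'.
    rewrite !mem_filter => /andP[newm _] /andP[newm' _] E.
    wlog mm' : m m' newm newm' E / m < m'.
      by case: (ltngtP m m') => // lt H; [apply: H | apply/esym/H].
    case/andP: newm' => _ /hasPn/(_ m); rewrite mem_iota add0n E eqxx andbT.
    by move=> /(_ mm'); case/andP: newm => ->.
  move=> z' /mapP[m]; rewrite mem_filter => /andP[/andP[hm _] _] ->.
  by exists (entry m).1; rewrite -surjective_pairing.
by have := size_nat_string ik; rewrite /p size_cat size_dbl; lia.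
Qed.

(** Comes from a copying machine. The existence of a program excludes the default value of [KC]. *)
Lemma KC_size (U : turing_machine) : universal U ->
  exists c, forall z u, (exists p, tm_computes U p u z) /\ KC U z u <= size z + c.
Proof.
move=> hU.
have [V HV] := mu_machine (tst := fun=> true) (out := fun q => q.1.1)
  ltac:(cmp_tac) ltac:(cmp_tac).
have [c Hc] := hU V; exists c => z u.
have [|w sw Uw] := Hc z u z; first by apply: (HV z u 0).
by split; [exists w|apply: leq_trans (KC_le Uw) sw].
Qed.

Definition strings_upto (m : nat) : seq string :=
  iter m (fun l => [::] :: map (cons true) l ++ map (cons false) l) [:: [::]].

Lemma strings_uptoS m : strings_upto m.+1 =
  [::] :: map (cons true) (strings_upto m) ++ map (cons false) (strings_upto m).
Proof. by []. Qed.

Lemma mem_strings_upto m p : (p \in strings_upto m) = (size p <= m).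
Proof.
elim: m p => [|m IH] p; first by case: p.
rewrite strings_uptoS inE mem_cat.
case: p => //= b p; rewrite ltnS -IH.
case: b; [rewrite orbC|]; rewrite mem_map; try by move=> ? ? [].
  by case: mapP => // -[? _].
by case: mapP => // -[? _].
Qed.

Lemma size_strings_upto m : (size (strings_upto m)).+1 = 2 ^ m.+1.
Proof.
elim: m => // m IH; rewrite strings_uptoS.
by rewrite [size (_ :: _)]/= size_cat !size_map [RHS]expnS -IH mul2n -addnn addnS addSn.
Qed.

Lemma cmp_strings_upto A (cA : coded A) (m : A -> nat) :
  cmp m -> cmp (fun a => strings_upto (m a)).
Proof. by move=> Hm; rewrite /strings_upto; cmp_tac. Qed.

(** * Reading a protocol from its encoding *)

Definition rects_of (Pi : string) : seq (seq (seq string)) :=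
  [seq map parse_seq (parse_seq r) | r <- parse_seq (nth [::] (parse_seq Pi) 0)].

(** A string that indexes no rectangle gives the empty list. It is vacuously [thin] but has no
    coordinates, hence it satisfies neither [rich] nor membership in an [alist]. *)
Definition rect_of (Pi z : string) : seq (seq string) :=
  nth [::] (rects_of Pi) (val_string z).

Definition coords (e : nat) (Pi z : string) : seq string :=
  undup [seq nth [::] c e | c <- rect_of Pi z].

Definition thin (r : nat) (Pi z : string) : bool :=
  all (fun c => count (fun R => c \in R) (rects_of Pi) <= 2 ^ r) (rect_of Pi z).

Ltac cmp_strings := idtac; lazymatch goal with
  | |- @cmp _ _ _ _ (fun x => strings_upto (@?m x)) => refine (@cmp_strings_upto _ _ m _)
  | |- @cmp _ _ _ _ (fun x => val_string (@?m x)) => refine (@cmp_val_string _ _ m _)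
  | |- @cmp _ _ _ _ (fun x => parse_seq (@?m x)) => refine (@cmp_parse _ _ m _)
  | |- @cmp _ _ _ _ (fun x => run ?M (@?s x) (@?p x) (@?u x)) =>
      refine (@cmp_run M _ _ s p u _ _ _)
  end.
Ltac cmp_user ::= cmp_strings.

Lemma cmp_rects_of A (cA : coded A) (Pi : A -> string) :
  cmp Pi -> cmp (fun a => rects_of (Pi a)).
Proof.
move=> HPi; have Hp : cmp parse_seq by apply: (cmp_parse (f := id)); cmp_tac.
by rewrite /rects_of; cmp_tac.
Qed.

Lemma cmp_rect_of A (cA : coded A) (Pi z : A -> string) :
  cmp Pi -> cmp z -> cmp (fun a => rect_of (Pi a) (z a)).
Proof.
by move=> HPi Hz; rewrite /rect_of; cmp_tac; exact: cmp_rects_of.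
Qed.

Ltac cmp_rect := idtac; lazymatch goal with
  | |- @cmp _ _ _ _ (fun x => rects_of (@?m x)) => refine (@cmp_rects_of _ _ m _)
  | |- @cmp _ _ _ _ (fun x => rect_of (@?m x) (@?z x)) => refine (@cmp_rect_of _ _ m z _ _)
  | |- _ => cmp_strings
  end.
Ltac cmp_user ::= cmp_rect.

Lemma cmp_coords A (cA : coded A) (e : A -> nat) (Pi z : A -> string) :
  cmp e -> cmp Pi -> cmp z -> cmp (fun a => coords (e a) (Pi a) (z a)).
Proof. by move=> He HPi Hz; rewrite /coords; cmp_tac. Qed.

Lemma cmp_thin A (cA : coded A) (r : A -> nat) (Pi z : A -> string) :
  cmp r -> cmp Pi -> cmp z -> cmp (fun a => thin (r a) (Pi a) (z a)).
Proof. by move=> Hr HPi Hz; rewrite /thin; cmp_tac. Qed.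

(** * Stage-wise enumerations *)

Section Stages.
Variables U F : turing_machine.

Definition outs (s m : nat) (u : string) : seq string :=
  undup (pmap (fun p => run U s p u) (strings_upto m)).

Definition tlist (s m r : nat) (Pi : string) : seq string :=
  [seq z <- outs s m Pi | thin r Pi z].

Definition vlist (s e a : nat) (Pi z : string) : seq string :=
  [seq x <- coords e Pi z | x \in outs s a Pi].

(* [x] has entered [vlist] before the size of the latter reached [2 ^ v.+1];
   the restriction bounds the number of partners of [z] at all stages. *)
Definition paired (s e a v : nat) (Pi z x : string) : bool :=
  has (fun s' => (x \in vlist s' e a Pi z) && (size (vlist s' e a Pi z) < 2 ^ v.+1))
    (iota 0 s.+1).

Definition alist (s e a v m r : nat) (Pi x : string) : seq string :=
  [seq z <- tlist s m r Pi | paired s e a v Pi z x].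

(** A rectangle of a protocol that computes f is monochromatic, so its first listed cell represents
    all of them. *)
Definition fval (s : nat) (Pi z : string) : option string :=
  run F s (nth [::] (head [::] (rect_of Pi z)) 0)
          (nth [::] (head [::] (rect_of Pi z)) 1).

Lemma cmp_outs A (cA : coded A) (s m : A -> nat) (u : A -> string) :
  cmp s -> cmp m -> cmp u -> cmp (fun a => outs (s a) (m a) (u a)).
Proof. by move=> Hs Hm Hu; rewrite /outs; cmp_tac. Qed.

Lemma cmp_tlist A (cA : coded A) (s m r : A -> nat) (u : A -> string) :
  cmp s -> cmp m -> cmp r -> cmp u -> cmp (fun a => tlist (s a) (m a) (r a) (u a)).
Proof.
move=> Hs Hm Hr Hu; rewrite /tlist; cmp_tac; last exact: cmp_outs.
by apply: cmp_thin; cmp_tac.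
Qed.

Lemma cmp_vlist A (cA : coded A) (s e a : A -> nat) (u z : A -> string) :
  cmp s -> cmp e -> cmp a -> cmp u -> cmp z ->
  cmp (fun x => vlist (s x) (e x) (a x) (u x) (z x)).
Proof.
move=> Hs He Ha Hu Hz; rewrite /vlist; cmp_tac; last exact: cmp_coords.
by apply: cmp_outs; cmp_tac.
Qed.

Lemma cmp_paired A (cA : coded A) (s e a v : A -> nat) (u z x : A -> string) :
  cmp s -> cmp e -> cmp a -> cmp v -> cmp u -> cmp z -> cmp x ->
  cmp (fun y => paired (s y) (e y) (a y) (v y) (u y) (z y) (x y)).
Proof.
by move=> Hs He Ha Hv Hu Hz Hx; rewrite /paired; cmp_tac; apply: cmp_vlist; cmp_tac.
Qed.

Lemma cmp_alist A (cA : coded A) (s e a v m r : A -> nat) (u x : A -> string) :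
  cmp s -> cmp e -> cmp a -> cmp v -> cmp m -> cmp r -> cmp u -> cmp x ->
  cmp (fun y => alist (s y) (e y) (a y) (v y) (m y) (r y) (u y) (x y)).
Proof.
move=> Hs He Ha Hv Hm Hr Hu Hx; rewrite /alist; cmp_tac; last exact: cmp_tlist.
by apply: cmp_paired; cmp_tac.
Qed.

Lemma cmp_fval A (cA : coded A) (s : A -> nat) (u z : A -> string) :
  cmp s -> cmp u -> cmp z -> cmp (fun a => fval (s a) (u a) (z a)).
Proof. by move=> Hs Hu Hz; rewrite /fval; cmp_tac. Qed.

(* The parameters are packed in one number [q], read as a list. *)
Definition prm (q i : nat) : nat := nth 0 (decode q) i.

Lemma prm_code (l : seq nat) i : prm (code l) i = nth 0 l i.
Proof.
rewrite /prm; congr nth; apply: (code_inj (coded := coded_seq coded_nat)).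
exact: decodeK.
Qed.

Lemma cmp_prm A (cA : coded A) (q : A -> nat) i : cmp q -> cmp (fun a => prm (q a) i).
Proof.
move=> Hq; have Hd : cmp decode by exists id; [exact: natc_id|move=> n; rewrite decodeK].
by rewrite /prm; cmp_tac.
Qed.

(** Parameters [[:: m; r; a; b; v; w]], condition [Pi]. Serves to describe the rectangle t. *)
Definition rich (k : (nat * string) * (nat * string)) : bool :=
  [&& k.2.2 \in tlist k.2.1 (prm k.1.1 0) (prm k.1.1 1) k.1.2,
      2 ^ prm k.1.1 4 <= size (vlist k.2.1 0 (prm k.1.1 2) k.1.2 k.2.2) &
      2 ^ prm k.1.1 5 <= size (vlist k.2.1 1 (prm k.1.1 3) k.1.2 k.2.2)].

Definition alist_at (q s : nat) (Pi x : string) : seq string :=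
  alist s (prm q 2) (prm q 3) (prm q 4) (prm q 0) (prm q 1) Pi x.

(** Parameters [[:: m; r; e; a; v; k]], condition [Pi]. Serves to describe x for [e = 0] and y for
    [e = 1]. *)
Definition popular (k : (nat * string) * (nat * string)) : bool :=
  2 ^ prm k.1.1 5 <= size (alist_at k.1.1 k.2.1 k.1.2 k.2.2).

(** Parameters [[:: m; r; e; a; v; j]], condition [enc_seq [:: x; Pi]]. Serves to describe the value
    of f. *)
Definition frequent (k : (nat * string) * (nat * string)) : bool :=
  2 ^ prm k.1.1 5 <=
  count (fun z => fval k.2.1 (nth [::] (parse_seq k.1.2) 1) z == Some k.2.2)
    (alist_at k.1.1 k.2.1 (nth [::] (parse_seq k.1.2) 1) (nth [::] (parse_seq k.1.2) 0)).

(** Parameters [[:: m; r; e; a; v]], condition [enc_seq [:: x; y; Pi]] with [y] the value of f.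
    Serves to describe t. *)
Definition consistent (k : (nat * string) * (nat * string)) : bool :=
  (k.2.2 \in alist_at k.1.1 k.2.1 (nth [::] (parse_seq k.1.2) 2) (nth [::] (parse_seq k.1.2) 0))
  && (fval k.2.1 (nth [::] (parse_seq k.1.2) 2) k.2.2 == Some (nth [::] (parse_seq k.1.2) 1)).

Lemma cmp_alist_at A (cA : coded A) (q s : A -> nat) (Pi x : A -> string) :
  cmp q -> cmp s -> cmp Pi -> cmp x -> cmp (fun a => alist_at (q a) (s a) (Pi a) (x a)).
Proof.
move=> Hq Hs HPi Hx; rewrite /alist_at.
by apply: cmp_alist => //; apply: cmp_prm.
Qed.

Lemma cmp_rich : cmp rich.
Proof.
rewrite /rich; cmp_tac; try (by apply: cmp_prm; cmp_tac).
- by apply: cmp_tlist; cmp_tac; apply: cmp_prm; cmp_tac.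
- by apply: cmp_vlist; cmp_tac; apply: cmp_prm; cmp_tac.
- by apply: cmp_vlist; cmp_tac; apply: cmp_prm; cmp_tac.
Qed.

Lemma cmp_popular : cmp popular.
Proof.
rewrite /popular; cmp_tac; first by apply: cmp_prm; cmp_tac.
by apply: cmp_alist_at; cmp_tac.
Qed.

Lemma cmp_frequent : cmp frequent.
Proof.
rewrite /frequent; cmp_tac; first by apply: cmp_prm; cmp_tac.
  by apply: cmp_fval; cmp_tac.
by apply: cmp_alist_at; cmp_tac.
Qed.

Lemma cmp_consistent : cmp consistent.
Proof.
rewrite /consistent; cmp_tac; first by apply: cmp_alist_at; cmp_tac.
by apply: cmp_fval; cmp_tac.
Qed.

Lemma outsP s m u z :
  reflect (exists2 p, size p <= m & run U s p u = Some z) (z \in outs s m u).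
Proof.
rewrite mem_undup mem_pmap; apply: (iffP mapP) => -[p].
  by rewrite mem_strings_upto => ? ->; exists p.
by move=> pm Ez; exists p; rewrite ?mem_strings_upto.
Qed.

Lemma size_outs s m u : size (outs s m u) <= 2 ^ m.+1.
Proof.
rewrite -size_strings_upto; apply: leq_trans (size_undup _) _.
by rewrite size_pmap; apply: leq_trans (count_size _ _) _.
Qed.

Lemma outs_mono s s' m u : s <= s' -> {subset outs s m u <= outs s' m u}.
Proof. by move=> ss z /outsP[p pm /(run_mono ss) Ez]; apply/outsP; exists p. Qed.

Lemma tlist_mono s s' m r u : s <= s' -> {subset tlist s m r u <= tlist s' m r u}.
Proof. by move=> ss z; rewrite !mem_filter => /andP[-> /(outs_mono ss)]. Qed.

Lemma tlist_uniq s m r u : uniq (tlist s m r u).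
Proof. by rewrite filter_uniq // undup_uniq. Qed.

Lemma vlist_mono s s' e a u z : s <= s' -> {subset vlist s e a u z <= vlist s' e a u z}.
Proof. by move=> ss x; rewrite !mem_filter => /andP[/(outs_mono ss)->]. Qed.

Lemma vlist_uniq s e a u z : uniq (vlist s e a u z).
Proof. by rewrite filter_uniq // undup_uniq. Qed.

Lemma size_vlist_mono s s' e a u z : s <= s' ->
  size (vlist s e a u z) <= size (vlist s' e a u z).
Proof. by move=> ss; apply: uniq_leq_size (vlist_uniq _ _ _ _ _) (vlist_mono ss). Qed.

Lemma size_vlist s e a u z : size (vlist s e a u z) <= 2 ^ a.+1.
Proof.
apply: leq_trans (size_outs s a u); apply: uniq_leq_size (vlist_uniq _ _ _ _ _) _.
by move=> x; rewrite mem_filter => /andP[].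
Qed.

(** The size restriction may fail at later stages; recording all earlier stages is what makes the
    relation monotone. *)
Lemma paired_mono s s' e a v u z x : s <= s' ->
  paired s e a v u z x -> paired s' e a v u z x.
Proof.
move=> ss /hasP[i]; rewrite mem_iota => /andP[_ i_s] Hi; apply/hasP; exists i => //.
by rewrite mem_iota /=; lia.
Qed.

Lemma alist_mono s s' e a v m r u x : s <= s' ->
  {subset alist s e a v m r u x <= alist s' e a v m r u x}.
Proof.
move=> ss z; rewrite !mem_filter -!mem_filter => /andP[/(paired_mono ss)-> H] /=.
exact: (tlist_mono ss).
Qed.

Lemma alist_uniq s e a v m r u x : uniq (alist s e a v m r u x).
Proof. by rewrite filter_uniq // tlist_uniq. Qed.

Lemma size_alist s e a v m r u x : size (alist s e a v m r u x) <= 2 ^ m.+1.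
Proof.
apply: leq_trans (size_outs s m u); rewrite !size_filter.
apply: leq_trans (count_size _ _) _.
by rewrite size_filter count_size.
Qed.

Lemma fval_mono s s' u z y : s <= s' -> fval s u z = Some y -> fval s' u z = Some y.
Proof. exact: run_mono. Qed.

End Stages.

(** * Counting *)

Lemma double_count (T1 T2 : eqType) (e : T1 -> T2 -> bool) (l1 : seq T1)
    (l2 : seq T2) (m n : nat) :
  {in l1, forall x, m <= count (e x) l2} ->
  {in l2, forall y, count (e^~ y) l1 <= n} ->
  size l1 * m <= size l2 * n.
Proof.
move=> lo hi.
have -> : size l1 * m = \sum_(x <- l1) m.
  by rewrite big_const_seq count_predT iter_addn addn0 mulnC.
have -> : size l2 * n = \sum_(y <- l2) n.
  by rewrite big_const_seq count_predT iter_addn addn0 mulnC.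
apply: (@leq_trans (\sum_(x <- l1) count (e x) l2)).
  by rewrite !big_seq; apply: leq_sum.
have -> : \sum_(x <- l1) count (e x) l2 = \sum_(y <- l2) count (e^~ y) l1.
  transitivity (\sum_(x <- l1) \sum_(y <- l2) e x y).
    by apply: eq_bigr => x _; rewrite -sum1_count big_mkcond; apply: eq_bigr => y _; case: (e x y).
  rewrite exchange_big; apply: eq_bigr => y _.
  by rewrite -sum1_count [RHS]big_mkcond; apply: eq_bigr => x _; case: (e x y).
by rewrite !big_seq; apply: leq_sum.
Qed.

(** [k] is the integer logarithm of the largest value of [g]. It exists classically and is not
    computed from [g]; programs receive it as a parameter. *)
Lemma log_level (g : nat -> nat) (b : nat) : (forall s, g s <= b) ->
  (exists s, 0 < g s) ->
  exists k, [/\ exists s, 2 ^ k <= g s, forall s, g s < 2 ^ k.+1 & 2 ^ k <= b].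
Proof.
move=> gb [s0 g0].
pose Q n := `[< exists s, g s = n >].
have exQ : exists n, Q n by exists (g s0); apply/asboolP; exists s0.
have leQ n : Q n -> n <= b by move=> /asboolP[s <-].
case: (ex_maxnP exQ leQ) => n /asboolP[s Es] nmax.
have n0 : 0 < n by apply: leq_trans g0 (nmax _ _); apply/asboolP; exists s0.
exists (trunc_log 2 n); split.
- by exists s; rewrite Es trunc_logP.
- move=> s'; apply: leq_ltn_trans (trunc_log_ltn _ _) => //.
  by apply: nmax; apply/asboolP; exists s'.
by apply: leq_trans (trunc_logP _ _) _; rewrite // -Es.
Qed.

(** [description] supplies a separate stage for every element, whereas counting needs a single one:
    for a finite list the maximum will do. *)
Lemma common_stage (T : eqType) (Q : nat -> T -> bool) (l : seq T) :
  (forall s s' z, s <= s' -> Q s z -> Q s' z) ->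
  {in l, forall z, exists s, Q s z} -> exists s, {in l, forall z, Q s z}.
Proof.
move=> mono; elim: l => [|z l IH] H; first by exists 0.
have [z' zl|s Hs] := IH; first by apply: H; rewrite inE zl orbT.
have [s' Hs'] := H z (mem_head _ _).
exists (maxn s s') => z'; rewrite inE => /orP[/eqP->|/Hs].
  by apply: mono Hs'; rewrite leq_maxr.
by apply: mono; rewrite leq_maxl.
Qed.

Lemma count_nth_le (T : Type) (x0 : T) (Q : pred T) (s : seq T) (I : seq nat) :
  uniq I -> {in I, forall i, i < size s /\ Q (nth x0 s i)} -> size I <= count Q s.
Proof.
move=> uI HI.
have -> : count Q s = size [seq i <- iota 0 (size s) | Q (nth x0 s i)].
  by rewrite size_filter -{1}(mkseq_nth x0 s) /mkseq count_map.
apply: uniq_leq_size => // i /HI[i_s Qi].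
by rewrite mem_filter Qi mem_iota.
Qed.

Section Bounds.
Variables U F : turing_machine.

Lemma rich_bound m r a b v w Pi (l : seq string) :
  (forall z x y, x \in coords 0 Pi z -> y \in coords 1 Pi z -> [:: x; y] \in rect_of Pi z) ->
  uniq l ->
  {in l, forall z, exists s, rich U ((code [:: m; r; a; b; v; w], Pi), (s, z))} ->
  size l * 2 ^ (v + w) <= 2 ^ (r + a.+1 + b.+1).
Proof.
move=> rectP ul ex.
pose Q s z := [&& z \in tlist U s m r Pi, 2 ^ v <= size (vlist U s 0 a Pi z) &
  2 ^ w <= size (vlist U s 1 b Pi z)].
have [s s' z ss /and3P[zt v1 w1]|z /ex[s]|S HS] := @common_stage _ Q l.
- rewrite /Q (tlist_mono ss zt) (leq_trans v1) ?size_vlist_mono //=.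
  by rewrite (leq_trans w1) ?size_vlist_mono.
- by rewrite /rich !prm_code; exists s.
pose e z (c : string * string) :=
  (c.1 \in vlist U S 0 a Pi z) && (c.2 \in vlist U S 1 b Pi z).
pose cells := [seq (x, y) | x <- outs U S a Pi, y <- outs U S b Pi].
have lo : {in l, forall z, 2 ^ (v + w) <= count (e z) cells}.
  move=> z /HS /and3P[_ v1 w1].
  pose c := [seq (x, y) | x <- vlist U S 0 a Pi z, y <- vlist U S 1 b Pi z].
  apply: (@leq_trans (size c)); first by rewrite size_allpairs expnD leq_mul.
  rewrite -size_filter; apply: uniq_leq_size.
    by apply: allpairs_uniq; rewrite ?vlist_uniq // => -[? ?] [? ?].
  move=> _ /allpairsP[[x y] [xv yv ->]].
  rewrite mem_filter /e xv yv; apply/allpairsP; exists (x, y); split=> //.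
    by move: xv; rewrite mem_filter => /andP[].
  by move: yv; rewrite mem_filter => /andP[].
have hi : {in cells, forall c, count (e^~ c) l <= 2 ^ r}.
  move=> [x y] _; rewrite -size_filter; set lc := filter _ l.
  have Hlc z : z \in lc -> [:: x; y] \in rect_of Pi z /\ thin r Pi z.
    rewrite mem_filter => /andP[/andP[]]; rewrite !mem_filter => /andP[_ xz] /andP[_ yz].
    by move=> /HS /and3P[]; rewrite mem_filter => /andP[tz _] _ _; split=> //; apply: rectP.
  have uc : uniq lc by rewrite filter_uniq.
  (* If some rectangle [z0] is counted at all, its thinness bounds the thickness of each of its
     cells, in particular of (x, y). *)
  case Elc : lc => [//|z0 lc']; rewrite -Elc.
  have [cz0 /allP/(_ _ cz0) bz0] := Hlc z0 ltac:(by rewrite Elc mem_head).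
  apply: leq_trans bz0; rewrite -(size_map val_string).
  apply: (@count_nth_le _ [::]); first by rewrite map_inj_uniq //; exact: val_string_inj.
  move=> _ /mapP[z /Hlc[cz _] ->]; split=> //.
  by rewrite ltnNge; apply/negP => /(nth_default [::]) E; move: cz; rewrite /rect_of E.
apply: leq_trans (double_count lo hi) _.
rewrite size_allpairs !expnD mulnC -mulnA; apply: leq_mul => //.
by apply: leq_mul; apply: size_outs.
Qed.

(** [vlist] grows with the stage, so all partners of [z] already lie in it at the last stage up to
    [S] that obeys the size restriction. *)
Lemma count_paired S e a v Pi z (l : seq string) : uniq l ->
  count (paired U S e a v Pi z) l <= 2 ^ v.+1.
Proof.
move=> ul; rewrite -size_filter; set lz := filter _ l.
pose ok s := size (vlist U s e a Pi z) < 2 ^ v.+1.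
have lzP x : x \in lz -> exists2 s, (s <= S) && ok s & x \in vlist U s e a Pi z.
  rewrite mem_filter => /andP[/hasP[s]]; rewrite mem_iota => /andP[_ sS] /andP[xs oks] _.
  by exists s; rewrite // -ltnS sS.
case Elz : lz => [//|x0 lz']; rewrite -Elz.
have ex : exists s, (s <= S) && ok s.
  by have [|s Hs _] := lzP x0; [rewrite Elz mem_head|exists s].
have bd s : (s <= S) && ok s -> s <= S by case/andP.
case: (ex_maxnP ex bd) => s /andP[_ oks] smax.
apply: leq_trans (ltnW oks); apply: uniq_leq_size; first by rewrite filter_uniq.
by move=> x /lzP[s' /smax ss]; apply: vlist_mono.
Qed.

Lemma popular_bound m r e a v k Pi (l : seq string) : uniq l ->
  {in l, forall x, exists s, popular U ((code [:: m; r; e; a; v; k], Pi), (s, x))} ->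
  size l * 2 ^ k <= 2 ^ (m.+1 + v.+1).
Proof.
move=> ul ex.
pose Q s x := 2 ^ k <= size (alist U s e a v m r Pi x).
have [s s' x ss H|x /ex[s]|S HS] := @common_stage _ Q l.
- apply: leq_trans H _; apply: uniq_leq_size (alist_mono ss).
  exact: alist_uniq.
- by rewrite /popular /alist_at !prm_code; exists s.
rewrite expnD; apply: (@leq_trans (size (outs U S m Pi) * 2 ^ v.+1)); last first.
  by apply: leq_mul => //; apply: size_outs.
apply: (@double_count _ _ (fun x z => paired U S e a v Pi z x)) => [x /HS|z _].
  move=> H; apply: leq_trans H _; rewrite size_filter count_filter.
  by apply: sub_count => z /= /andP[].
exact: count_paired.
Qed.

(** A rectangle has at most one value, so different values of f use disjoint parts of the
    [alist]. *)
Lemma frequent_bound m r e a v j k x Pi (l : seq string) : uniq l ->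
  (forall s, size (alist U s e a v m r Pi x) < 2 ^ k.+1) ->
  {in l, forall y, exists s,
    frequent U F ((code [:: m; r; e; a; v; j], enc_seq [:: x; Pi]), (s, y))} ->
  size l * 2 ^ j <= 2 ^ k.+1.
Proof.
move=> ul bd ex.
pose Q s y := 2 ^ j <= count (fun z => fval F s Pi z == Some y) (alist U s e a v m r Pi x).
have [s s' y ss H|y /ex[s]|S HS] := @common_stage _ Q l.
- apply: leq_trans H _; rewrite -!size_filter; apply: uniq_leq_size.
    by rewrite filter_uniq // alist_uniq.
  move=> z; rewrite mem_filter => /andP[/eqP E zs].
  by rewrite mem_filter (fval_mono ss E) eqxx (alist_mono ss zs).
- by rewrite /frequent /alist_at !prm_code parse_seqK; exists s.
apply: (@leq_trans (size (alist U S e a v m r Pi x) * 1)); last by rewrite muln1 ltnW.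
apply: (@double_count _ _ (fun y z => fval F S Pi z == Some y)) => [y /HS //|z _].
case E : (fval F S Pi z) => [y0|]; last by rewrite (eq_count (a2 := pred0)) ?count_pred0.
rewrite (eq_count (a2 := pred1 y0)) ?count_uniq_mem ?leq_b1 // => y /=.
Qed.

Lemma consistent_bound m r e a v j x y Pi (l : seq string) : uniq l ->
  (forall s, count (fun z => fval F s Pi z == Some y) (alist U s e a v m r Pi x) < 2 ^ j.+1) ->
  {in l, forall z, exists s,
    consistent U F ((code [:: m; r; e; a; v], enc_seq [:: x; y; Pi]), (s, z))} ->
  size l <= 2 ^ j.+1.
Proof.
move=> ul bd ex.
pose Q s z := (z \in alist U s e a v m r Pi x) && (fval F s Pi z == Some y).
have [s s' z ss|z /ex[s]|S HS] := @common_stage _ Q l.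
- by move=> /andP[/(alist_mono ss) zs /eqP/(fval_mono ss) E]; rewrite /Q zs E eqxx.
- by rewrite /consistent /alist_at !prm_code parse_seqK; exists s.
apply: leq_trans (ltnW (bd S)); rewrite -size_filter; apply: uniq_leq_size => // z.
by move=> /HS /andP[zs E]; rewrite mem_filter E.
Qed.

End Bounds.

(** The form in which counting bounds arise, with the exponent on the left to avoid truncated
    subtraction. *)
Lemma description_pow (U : turing_machine) (D : (nat * string) * (nat * string) -> bool) :
  universal U -> cmp D ->
  exists c, forall q u z k n, (exists s, D ((q, u), (s, z))) ->
    (forall l : seq string, uniq l ->
       {in l, forall z', exists s, D ((q, u), (s, z'))} -> size l * 2 ^ k <= 2 ^ n) ->
    KC U z u + k <= n + 2 * size (nat_string q) + c.
Proof.
move=> hU HD; have [c Hc] := description hU HD; exists c => q u z k n ex bd.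
(* The bound for the one-element list of [z] already forces this. *)
have kn : k <= n.
  have := bd [:: z] isT; rewrite mul1n leq_exp2l //; apply.
  by move=> z'; rewrite inE => /eqP->.
suff : KC U z u <= n - k + 2 * size (nat_string q) + c by lia.
apply: Hc => // l ul Hl; rewrite -(@leq_pmul2r (2 ^ k)) ?expn_gt0 //.
by rewrite -expnD subnK // bd.
Qed.

(** * Bit length of coded parameters *)

Lemma leq_pairn x y : pairn x y <= (x + y).+1 ^ 2.
Proof.
have H n : tri n + n <= n.+1 ^ 2.
  elim: n => // n; rewrite -!mulnn [tri n.+1]/=; move: (tri n) => t; nia.
apply: leq_trans (H (x + y)); rewrite /pairn; lia.
Qed.

(** Pairing is quadratic: from E to (E * B)^2 per entry, so the exponent e of B becomes 2 * e + 2.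
    For a fixed number of parameters the code is polynomial in B and has O(log B) bits. *)
Fixpoint code_exponent (d : nat) : nat :=
  if d is d'.+1 then 2 * code_exponent d' + 2 else 1.

(** The slack of two in [a.+2 <= B] yields [a + c + 2 <= E * B], where [c] is the code of the tail;
    this absorbs the successors in [code_seq] and [leq_pairn]. *)
Lemma code_lt (B : nat) (l : seq nat) : {in l, forall a, a.+2 <= B} -> 2 <= B ->
  code l < B ^ code_exponent (size l).
Proof.
move=> + B2; elim: l => [|a l IH] lB; first by rewrite /= expn1 ltnW.
have aB : a.+2 <= B by apply: lB; rewrite mem_head.
have {}IH : code l < B ^ code_exponent (size l).
  by apply: IH => x xl; apply: lB; rewrite inE xl orbT.
have -> : code (a :: l) = (pairn a (code l)).+1 by [].
have -> : B ^ code_exponent (size (a :: l)) = (B ^ code_exponent (size l) * B) ^ 2.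
  by rewrite [size _]/= [code_exponent _]/= expnD mulnC expnM mulnC expnAC -expnMn.
have pc : pairn a (code l) <= (a + code l).+1 ^ 2 by exact: leq_pairn.
move: IH pc.
move: (B ^ code_exponent (size l)) => E; move: (code l) => c cE pc.
have h : a + c + 2 <= E * B by nia.
have h2 : (a + c + 2) ^ 2 <= (E * B) ^ 2 by rewrite leq_exp2r.
apply: leq_trans h2; move: pc; rewrite addn2 -!mulnn.
by rewrite [in X in _ -> _ < X]mulSn [in X in _ -> _ < X]mulnS; lia.
Qed.

(** * The inequality *)

Section DecodeProtocol.
Variables (n1 n2 : nat) (P : protocol n1 n2).
Local Notation Pi := (enc_protocol P).

Definition cell_strings (c : cell n1 n2) : seq string := [:: tval c.1; tval c.2].

Lemma cell_strings_inj : injective cell_strings.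
Proof. by move=> [x y] [x' y'] [/val_inj-> /val_inj->]. Qed.

Lemma rects_ofE : rects_of Pi = [seq map cell_strings (enum R) | R : {set cell n1 n2} <- rects P].
Proof.
rewrite /rects_of /enc_protocol parse_seqK [nth _ _ 0]/= parse_seqK -map_comp.
apply: eq_map => R /=; rewrite /enc_rect parse_seqK -map_comp.
by apply: eq_map => c /=; rewrite parse_seqK.
Qed.

Lemma rect_of_string R : R \in rects P ->
  rect_of Pi (rect_string P R) = map cell_strings (enum R).
Proof.
move=> RP; rewrite /rect_of rects_ofE /rect_string val_nat_string.
by rewrite (nth_map set0) ?index_mem // nth_index.
Qed.

(** The only point at which rectangles being products enters. It lets [rich_bound] count all |V| *
    |W| pairs of a rectangle. *)
Lemma rect_of_product z x y :
  x \in coords 0 Pi z -> y \in coords 1 Pi z -> [:: x; y] \in rect_of Pi z.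
Proof.
rewrite !mem_undup /rect_of rects_ofE.
case: (ltnP (val_string z) (size (rects P))) => zP; last first.
  by rewrite [nth _ _ _]nth_default // size_map.
rewrite (nth_map set0) //; set R := nth _ _ _.
have [A [B ->]] := rects_rectangle (mem_nth set0 zP : R \in rects P).
case/mapP=> _ /mapP[[x1 y1] + ->] -> /= /mapP[_ /mapP[[x2 y2] + ->]] -> /=.
rewrite !mem_enum !in_setX /= => /andP[x1A _] /andP[_ y2B].
by apply/mapP; exists (x1, y2); rewrite // mem_enum in_setX x1A.
Qed.

Lemma rect_thin R r : R \in rects P -> thickness P R <= 2 ^ r ->
  thin r Pi (rect_string P R).
Proof.
move=> RP Rr; rewrite /thin rect_of_string //; apply/allP => _ /mapP[c + ->].
rewrite mem_enum => cR; apply: leq_trans Rr.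
rewrite rects_ofE count_map; apply: leq_trans (leq_bigmax_cond _ cR).
rewrite /cell_thickness leq_eqVlt; apply/orP; left; apply/eqP.
by apply: eq_count => R' /=; rewrite mem_map ?mem_enum //; exact: cell_strings_inj.
Qed.

Lemma mem_coords0 R (c : cell n1 n2) : R \in rects P -> c \in R ->
  tval c.1 \in coords 0 Pi (rect_string P R).
Proof.
move=> RP cR; rewrite mem_undup rect_of_string // -map_comp.
by apply/mapP; exists c; rewrite ?mem_enum.
Qed.

Lemma mem_coords1 R (c : cell n1 n2) : R \in rects P -> c \in R ->
  tval c.2 \in coords 1 Pi (rect_string P R).
Proof.
move=> RP cR; rewrite mem_undup rect_of_string // -map_comp.
by apply/mapP; exists c; rewrite ?mem_enum.
Qed.

Lemma fval_rect (F : turing_machine) (f : string -> string -> string) R c :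
  (forall x y, tm_computes F x y (f x y)) -> protocol_computes P f ->
  R \in rects P -> c \in R ->
  exists s, fval F s Pi (rect_string P R) = Some (f c.1 c.2).
Proof.
move=> Ff Pf RP cR; rewrite /fval rect_of_string //.
have : c \in enum R by rewrite mem_enum.
case ER : (enum R) => [//|c0 l] _ /=.
have c0R : c0 \in R by rewrite -mem_enum ER mem_head.
rewrite (Pf R RP c c0 cR c0R).
by have [s Es] := (tm_computesP _ _ _ _).1 (Ff c0.1 c0.2); exists s.
Qed.

End DecodeProtocol.

Lemma size_param (l : seq nat) h : 0 < h -> all (fun a => a.+2 <= 2 ^ h) l ->
  size (nat_string (code l)) <= h * code_exponent (size l).
Proof.
move=> h0 /allP lh; apply: size_nat_string; rewrite expnM; apply: code_lt => //.
by rewrite -[X in X <= _]expn1 leq_exp2l.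
Qed.

(* [k] is the logarithm of the number of rectangles that remain possible for
   [t] once [x] is known. *)
Lemma side_bound (U F : turing_machine) : universal U ->
  exists c, forall (Pi t x y : string) e a v m r h,
    (exists s, t \in tlist U s m r Pi) ->
    (exists s, x \in vlist U s e a Pi t) ->
    (forall s, size (vlist U s e a Pi t) < 2 ^ v.+1) ->
    (exists s, fval F s Pi t = Some y) ->
    all (fun i => i.+2 <= 2 ^ h) [:: m.+1; r; e; a; v] ->
    exists k,
      KC U x Pi + k <= m + v + 2 + 2 * (h * code_exponent 6) + c /\
      KC U y (enc_seq [:: x; Pi]) + KC U t (enc_seq [:: x; y; Pi])
        <= k + 2 + 4 * (h * code_exponent 6) + c.
Proof.
move=> hU.
have [c1 H1] := description_pow hU (cmp_popular U).
have [c2 H2] := description_pow hU (cmp_frequent U F).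
have [c3 H3] := description_pow hU (cmp_consistent U F).
exists (c1 + c2 + c3) => Pi t x y e a v m r h [s1 ts] [s2 xs] vb [s3 fs] hb.
have /and5P[hm hr he ha /andP[hv _]] := hb.
have h0 : 0 < h by case: (h) hm.
pose S := maxn s1 (maxn s2 s3).
have xA : t \in alist U S e a v m r Pi x.
  rewrite mem_filter; apply/andP; split; last by apply: tlist_mono ts; rewrite leq_maxl.
  (* For t itself the size restriction holds at all stages, so truncation never removes x. *)
  apply/hasP; exists s2; first by rewrite mem_iota /= /S; lia.
  by rewrite xs vb.
have tS : fval F S Pi t = Some y by apply: fval_mono fs; rewrite /S; lia.
have [s||k [exk bk km]] := @log_level (fun s => size (alist U s e a v m r Pi x)) (2 ^ m.+1).
- exact: size_alist.
- by exists S; case: (alist _ _ _ _ _ _ _ _ _) xA.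
pose g s := count (fun z => fval F s Pi z == Some y) (alist U s e a v m r Pi x).
(* [2 ^ j] approximates the number of candidates with the value of t. The exponent [j] cancels
   between [Ef] and [Et]. *)
have [s||j [exj bj jm]] := @log_level g (2 ^ m.+1).
- by apply: leq_trans (count_size _ _) (size_alist _ _ _ _ _ _ _ _ _).
- by exists S; rewrite -has_count; apply/hasP; exists t; rewrite ?tS.
rewrite !leq_exp2l // in km jm.
(* Both [k] and [j] may reach [m.+1], which is why the size hypothesis mentions [m.+1] instead of
   [m]. *)
have q6 i : i <= m.+1 ->
    size (nat_string (code [:: m; r; e; a; v; i])) <= h * code_exponent 6.
  move=> im; apply: (@size_param [:: m; r; e; a; v; i]) => //=.
  by rewrite hr he ha hv !(leq_trans _ hm).
have q5 : size (nat_string (code [:: m; r; e; a; v])) <= h * code_exponent 6.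
  apply: (@leq_trans (h * code_exponent 5)); last by rewrite leq_mul2l orbT.
  apply: (@size_param [:: m; r; e; a; v]) => //=.
  by rewrite hr he ha hv (leq_trans _ hm).
exists k; split.
  have Ep : KC U x Pi + k <=
      m.+1 + v.+1 + 2 * size (nat_string (code [:: m; r; e; a; v; k])) + c1.
    apply: H1; last by move=> l ul Hl; apply: popular_bound Hl.
    by have [s Hs] := exk; exists s; rewrite /popular /alist_at !prm_code.
  by have := q6 _ km; lia.
have Ef : KC U y (enc_seq [:: x; Pi]) + j <=
    k.+1 + 2 * size (nat_string (code [:: m; r; e; a; v; j])) + c2.
  apply: H2.
    by have [s Hs] := exj; exists s; rewrite /frequent /alist_at !prm_code parse_seqK.
  by move=> l ul Hl; apply: frequent_bound Hl.
have Et : KC U t (enc_seq [:: x; y; Pi]) + 0 <=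
    j.+1 + 2 * size (nat_string (code [:: m; r; e; a; v])) + c3.
  apply: H3.
    exists S; rewrite /consistent /alist_at !prm_code parse_seqK.
    by apply/andP; split; [exact: xA | rewrite [nth _ _ _]/= tS].
  by move=> l ul Hl; rewrite muln1; apply: consistent_bound Hl.
by have := q6 _ jm; lia.
Qed.

Lemma params_fit n c h m r a v e : 4 * n + 4 * c + 4 <= 2 ^ h -> m <= n + c ->
  r <= 4 * n + 4 * c -> a <= n + c -> v <= a.+1 -> e <= 1 ->
  [/\ m.+3 <= 2 ^ h, r.+2 <= 2 ^ h, e.+2 <= 2 ^ h, a.+2 <= 2 ^ h & v.+2 <= 2 ^ h].
Proof. by move: (2 ^ h) => N; split; lia. Qed.

(** Adding the five inequalities cancels a, b, v, w, kx, ky and one m. Here 14 = 2 + 2 * (2 + 4)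
    collects the parameter lengths, and 10 the roundings to powers of two. *)
Lemma sum_bound m r a b v w kx ky fx fy tx ty q g c1 c2 d c :
  m + (v + w) <= r + a.+1 + b.+1 + 2 * q + c1 ->
  a + kx <= m + v + 2 + 2 * g + c2 -> fx + tx <= kx + 2 + 4 * g + c2 ->
  b + ky <= m + w + 2 + 2 * g + c2 -> fy + ty <= ky + 2 + 4 * g + c2 ->
  q <= g -> g <= d -> 10 + c1 + 4 * c2 <= c ->
  fx + fy + tx + ty <= m + r + (c + 14 * d).
Proof. lia. Qed.

Lemma complexity_bound (U : turing_machine) (f : string -> string -> string) :
  universal U -> computable f ->
  exists C, forall n1 n2 (P : protocol n1 n2), protocol_computes P f ->
    forall (x : n1.-tuple bool) (y : n2.-tuple bool) (r : nat),
    let fxy := f x y in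
    let txy := rect_string P (rect_at P (x, y)) in
    let Pi := enc_protocol P in
    let n := maxn (maxn (size x) (size y)) (maxn (size fxy) (size txy)) in
    thickness P (rect_at P (x, y)) <= 2 ^ r ->
    KC U fxy (enc_seq [:: tval x; Pi]) + KC U fxy (enc_seq [:: tval y; Pi])
    + KC U txy (enc_seq [:: tval x; fxy; Pi]) + KC U txy (enc_seq [:: tval y; fxy; Pi])
    <= KC U txy Pi + r + C * up_log 2 (n + 2).
Proof.
move=> hU [F HF].
have [c0 H0] := KC_size hU.
have [c1 H1] := description_pow hU (cmp_rich U).
have [c2 H2] := side_bound F hU.
exists (10 + c1 + 4 * c2 + 14 * ((c0 + 3) * code_exponent 6)).
move=> n1 n2 P Pf x y r fxy txy Pi n thr.
set L := up_log 2 (n + 2).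
have nL : n + 2 <= 2 ^ L by apply: up_logP.
have L1 : 0 < L by rewrite lt0n; apply/eqP => L0; move: nL; rewrite L0; lia.
have [nx ny nf nt] : [/\ size x <= n, size y <= n, size fxy <= n & size txy <= n].
  by rewrite /n !leq_max !leqnn !orbT.
set fx := KC U fxy (enc_seq [:: tval x; Pi]).
set fy := KC U fxy (enc_seq [:: tval y; Pi]).
set tx := KC U txy (enc_seq [:: tval x; fxy; Pi]).
set ty := KC U txy (enc_seq [:: tval y; fxy; Pi]).
(* For larger [r] the claim is trivial, each of the four complexities being at most [n + c0].
   Otherwise [r] can be passed as a parameter of O(log n) bits. *)
case: (leqP r (4 * n + 4 * c0)) => rn; last first.
  have := (H0 fxy (enc_seq [:: tval x; Pi])).2; rewrite -/fx.
  have := (H0 fxy (enc_seq [:: tval y; Pi])).2; rewrite -/fy.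
  have := (H0 txy (enc_seq [:: tval x; fxy; Pi])).2; rewrite -/tx.
  have := (H0 txy (enc_seq [:: tval y; fxy; Pi])).2; rewrite -/ty.
  by lia.
have RP := rect_at_rects P (x, y); have cR := mem_rect_at P (x, y).
have [[pt Ut] mt] := H0 txy Pi; have {pt Ut} [pt st /tm_computesP[s1 Ut]] := KC_program Ut.
have [[px Ux] ax] := H0 (tval x) Pi; have {px Ux} [px sx /tm_computesP[s2 Ux]] := KC_program Ux.
have [[py Uy] bY] := H0 (tval y) Pi; have {py Uy} [py sy /tm_computesP[s3 Uy]] := KC_program Uy.
set m := KC U txy Pi in mt st *; set a := KC U (tval x) Pi in ax sx.
set b := KC U (tval y) Pi in bY sy.
have tT : txy \in tlist U s1 m r Pi.
  rewrite mem_filter rect_thin //; apply/outsP; exists pt => //.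
  by rewrite st.
have xV : tval x \in vlist U s2 0 a Pi txy.
  rewrite mem_filter; apply/andP; split; last exact: (mem_coords0 RP cR).
  by apply/outsP; exists px; rewrite ?sx.
have yV : tval y \in vlist U s3 1 b Pi txy.
  rewrite mem_filter; apply/andP; split; last exact: (mem_coords1 RP cR).
  by apply/outsP; exists py; rewrite ?sy.
have [s||v [exv bv va]] := @log_level (fun s => size (vlist U s 0 a Pi txy)) (2 ^ a.+1).
- exact: size_vlist.
- by exists s2; case: (vlist _ _ _ _ _ _) xV.
have [s||w [exw bw wb]] := @log_level (fun s => size (vlist U s 1 b Pi txy)) (2 ^ b.+1).
- exact: size_vlist.
- by exists s3; case: (vlist _ _ _ _ _ _) yV.
rewrite !leq_exp2l // in va wb.
(* Chosen so that [2 ^ h >= (n + 2) * (c0 + 1) * 4], which leaves room for every parameter. As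
   [L >= 1], [h <= (c0 + 3) * L]. *)
pose h := L + c0 + 2.
have hb : 4 * n + 4 * c0 + 4 <= 2 ^ h.
  have c02 : c0 < 2 ^ c0 by apply: ltn_expl.
  apply: (@leq_trans ((n + 2) * (c0 + 1) * 4)); first by move: (n) => k; clear; nia.
  by rewrite /h !expnD; apply: leq_mul => //; apply: leq_mul => //; rewrite addn1.
have mn : m <= n + c0 by apply: leq_trans mt _; rewrite leq_add2r.
have an : a <= n + c0 by apply: leq_trans ax _; rewrite leq_add2r.
have bn : b <= n + c0 by apply: leq_trans bY _; rewrite leq_add2r.
have [hm hr h0 ha hv] := params_fit hb mn rn an va (isT : 0 <= 1).
have [_ _ h1 hb' hw] := params_fit hb mn rn bn wb (isT : 1 <= 1).
have [s Hs] := fval_rect HF Pf RP cR.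
have [|||||kx [Ax Bx]] := H2 Pi txy (tval x) fxy 0 a v m r h.
- by exists s1.
- by exists s2.
- exact: bv.
- by exists s.
- by rewrite /= hm hr h0 ha hv.
have [|||||ky [Ay By]] := H2 Pi txy (tval y) fxy 1 b w m r h.
- by exists s1.
- by exists s3.
- exact: bw.
- by exists s.
- by rewrite /= hm hr h1 hb' hw.
have Er : m + (v + w) <= r + a.+1 + b.+1 +
    2 * size (nat_string (code [:: m; r; a; b; v; w])) + c1.
  apply: H1; last by move=> l ul Hl; apply: rich_bound Hl => //; exact: rect_of_product.
  have [sv Hv] := exv; have [sw Hw] := exw.
  (* A stage by which t has appeared and both its sets have reached their levels. *)
  exists (maxn s1 (maxn sv sw)); rewrite /rich !prm_code; apply/and3P; split.
  - by apply: tlist_mono tT; rewrite leq_maxl.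
  - by apply: leq_trans Hv _; apply: size_vlist_mono; rewrite !leq_max leqnn !orbT.
  - by apply: leq_trans Hw _; apply: size_vlist_mono; rewrite !leq_max leqnn !orbT.
have q6 : size (nat_string (code [:: m; r; a; b; v; w])) <= h * code_exponent 6.
  apply: (@size_param [:: m; r; a; b; v; w]); first by rewrite /h addn2.
  by rewrite /= hr ha hb' hv hw (leq_trans _ hm).
have hL : h * code_exponent 6 <= (c0 + 3) * code_exponent 6 * L.
  rewrite mulnAC leq_mul2r; apply/orP; right.
  rewrite /h -addnA addnC -[3]/(2 + 1) addnA mulnDl mul1n leq_add2r.
  by rewrite leq_pmulr.
have cL : 10 + c1 + 4 * c2 <= (10 + c1 + 4 * c2) * L by rewrite leq_pmulr.
rewrite mulnDl -[14 * _ * _]mulnA.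
exact: (sum_bound Er Ax Bx Ay By q6 hL cL).
Qed.

(** * Passage to real logarithms *)

Import Order.TTheory GRing.Theory Num.Theory.
Local Open Scope ring_scope.

Lemma expn_log2 (R : realType) (j k : nat) : (2 ^ j <= k)%N -> j%:R <= log2 (k%:R : R).
Proof.
move=> jk; have ln2 : 0 < ln (2 : R) by rewrite ln_gt0 // ltr1n.
have k0 : (0 < k)%N by apply: leq_trans jk; rewrite expn_gt0.
rewrite /log2 ler_pdivlMr // mulr_natl -lnXn ?ltr0n //.
by rewrite ler_ln ?posrE ?exprn_gt0 ?ltr0n // -natrX ler_nat.
Qed.

Lemma up_log_log2 (R : realType) (k : nat) : (0 < k)%N ->
  (up_log 2 k)%:R <= log2 (k%:R : R) + 1.
Proof.
case: k => [//|[|k]] _; first by rewrite up_log1 /log2 ln1 mul0r add0r ler01.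
have /andP[lt_k _] := up_log_bounds (isT : (1 < 2)%N) (isT : (1 < k.+2)%N).
have := expn_log2 R (ltnW lt_k).
have : (up_log 2 k.+2 <= (up_log 2 k.+2).-1 + 1)%N by case: (up_log _ _) => // u; rewrite addn1.
by rewrite -(ler_nat R) natrD; lra.
Qed.

Theorem theorem4p1 (R : realType) (U : turing_machine) (hU : universal U)
    (f : string -> string -> string) (hf : computable f) :
  exists K : R, forall (n1 n2 : nat) (P : protocol n1 n2),
    protocol_computes P f ->
    forall (x : n1.-tuple bool) (y : n2.-tuple bool),
    let fxy : string := f x y in
    let txy : string := rect_string P (rect_at P (x, y)) in
    let Pi : string := enc_protocol P in
    let n : nat := maxn (maxn (size x) (size y)) (maxn (size fxy) (size txy)) in
    (KC U txy Pi)%:R >=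
      (KC U fxy (enc_seq [:: tval x; Pi]))%:R
      + (KC U fxy (enc_seq [:: tval y; Pi]))%:R
      + (KC U txy (enc_seq [:: tval x; fxy; Pi]))%:R
      + (KC U txy (enc_seq [:: tval y; fxy; Pi]))%:R
      - log2 (thickness P (rect_at P (x, y)))%:R
      - K * log2 (n + 2)%:R :> R.
Proof.
have [C HC] := complexity_bound hU hf.
(* Rounding costs at most 1 in each logarithm, and [1 <= log2 (n + 2)]: the factor 2 pays for
   [up_log 2 (n + 2)], the summand 1 for rounding log rho. *)
exists (2 * C%:R + 1) => n1 n2 P Pf x y; cbv zeta.
set n := maxn _ _; set rho := thickness P (rect_at P (x, y)).
(* The rectangle contains its own cell (x, y), so the logarithm of [rho] is taken of a positive
   number. *)
have rho0 : (0 < rho)%N.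
  apply: leq_trans (leq_bigmax_cond _ (mem_rect_at P (x, y))).
  rewrite -has_count; apply/hasP; exists (rect_at P (x, y)).
    exact: rect_at_rects.
  exact: mem_rect_at.
have := HC n1 n2 P Pf x y (up_log 2 rho) (up_logP rho (isT : (1 < 2)%N)).
cbv zeta; rewrite -/n -(ler_nat R) => sum_le; rewrite !natrD natrM in sum_le.
have lrho := up_log_log2 R rho0.
have ln2 := @up_log_log2 R (n + 2) ltac:(by rewrite addn2).
have l1 : 1 <= log2 ((n + 2)%:R : R) by apply: (expn_log2 R (j := 1)); rewrite leq_addl.
have c0 : 0 <= C%:R :> R by rewrite ler0n.
have cl : C%:R * (up_log 2 (n + 2))%:R <= C%:R * (2 * log2 (n + 2)%:R) :> R.
  by apply: ler_wpM2l => //; lra.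
by lra.
Qed.
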